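(* Let $\varphi:M^m\to\mathbb{R}^{m+1}$ be a compact non-minimal biconservative hypersurface. If $m\geq 7$ and $|A|^2\leq\frac{m^2f^2}{m-1}$ on $M$, then $\nabla A=0$ and $\varphi(M)$ is congruent to the hypersphere $\mathbb{S}^m(r)$ of radius $r$ (for some $r>0$).
   Context: All manifolds are connected, oriented and of dimension at least two; compact means compact without boundary. A hypersurface $\varphi:M^m\to\mathbb{R}^{m+1}$ is an isometric immersion of an $m$-dimensional Riemannian manifold $M$; $A$ is its shape operator with respect to a chosen unit normal vector field, $f=\frac1m\operatorname{trace}A$ is the mean curvature function, and $|A|^2=\operatorname{trace}A^2$. $\nabla$ is the Levi-Civita connection of $M$ and $(\nabla A)(X,Y)=\nabla_X(AY)-A(\nabla_XY)$. Non-minimal means that $f$ is not identically zero. The hypersurface is biconservative if $A(\operatorname{grad}f)=-\frac m2 f\operatorname{grad}f$ on $M$. $\mathbb{S}^m(r)$ is the round hypersphere of radius $r$ in $\mathbb{R}^{m+1}$. *)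

(* Defs.v *)
From HB Require Import structures.
From mathcomp Require Import all_boot all_order all_algebra.
From mathcomp Require Import all_classical all_reals all_analysis.
From mathcomp Require Import ring.

Set Implicit Arguments.
Unset Strict Implicit.
Unset Printing Implicit Defensive.
Import Order.TTheory GRing.Theory Num.Theory.
Import numFieldNormedType.Exports.
Local Open Scope classical_set_scope.
Local Open Scope ring_scope.

(** * Euclidean space

  The library norm on ['rV[R]_n] is the sup norm: it has the right topology but
  not the right metric, hence [dot] and [enorm]. *)

Definition dot (R : realType) (n : nat) (u v : 'rV[R]_n) : R :=
  \sum_(i < n) u 0 i * v 0 i.

Definition enorm (R : realType) (n : nat) (u : 'rV[R]_n) : R :=
  Num.sqrt (dot u u).

(* centred at the origin; S^m(r) is [sphere m.+1 r] *)
Definition sphere (R : realType) (n : nat) (r : R) : set 'rV[R]_n :=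
  [set x | enorm x = r].

Definition congruent (R : realType) (n : nat) (S T : set 'rV[R]_n) : Prop :=
  exists F : 'rV[R]_n -> 'rV[R]_n,
    (forall x y, enorm (F x - F y) = enorm (x - y)) /\ F @` S = T.

(** * Smooth maps on open subsets of normed spaces *)

Fixpoint Cn_on (R : realType) (V W : normedModType R) (k : nat)
    (D : set V) (f : V -> W) : Prop :=
  match k with
  | 0 => forall x, D x -> {for x, continuous f}
  | k'.+1 => (forall x, D x -> differentiable f x) /\
             (forall v, Cn_on k' D (fun x => 'D_v f x))
  end.

Definition smooth_on (R : realType) (V W : normedModType R)
    (D : set V) (f : V -> W) : Prop := forall k, Cn_on k D f.

(** * Manifolds *)

(* [param] is the inverse of [coord]; its values outside [cod] and those of
   [coord] outside [dom] are irrelevant. *)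
Record chart (R : realType) (m : nat) (M : topologicalType) := Chart {
  dom : set M;
  coord : M -> 'rV[R]_m;
  param : 'rV[R]_m -> M;
  dom_open : open dom;
  cod_open : open (coord @` dom);
  coordK : forall p, dom p -> param (coord p) = p;
  chart_continuous : forall p, dom p -> {for p, continuous coord};
  param_continuous : forall x, (coord @` dom) x -> {for x, continuous param}
}.

Definition cod (R : realType) (m : nat) (M : topologicalType)
  (c : chart R m M) : set 'rV[R]_m := coord c @` dom c.

(* The transition maps of the atlas have positive Jacobian determinant, which
   is the orientation. [chart_at] only selects a chart around each point. *)
Record orientedManifold (R : realType) (m : nat) := OrientedManifold {
  carrier :> topologicalType;
  manifold_hausdorff : hausdorff_space carrier;
  manifold_second_countable : @second_countable carrier;
  manifold_connected : connected [set: carrier];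
  atlas_index : Type;
  atlas : atlas_index -> chart R m carrier;
  chart_at : carrier -> atlas_index;
  chart_atP : forall p, dom (atlas (chart_at p)) p;
  transition_smooth : forall i j,
    smooth_on (coord (atlas i) @` (dom (atlas i) `&` dom (atlas j)))
              (coord (atlas j) \o param (atlas i));
  transition_oriented : forall i j p, dom (atlas i) p -> dom (atlas j) p ->
    0 < \det ('J (coord (atlas j) \o param (atlas i)) (coord (atlas i) p))
}.

Section Calculus.
Variables (R : realType) (m : nat) (M : orientedManifold R m).
Local Notation idx := (atlas_index M).

(* ['J] acts on row vectors on the right: row k is the k-th partial derivative. *)
Definition jac (n : nat) (F : M -> 'rV[R]_n) (i : idx) (p : M) : 'M[R]_(m, n) :=
  'J (F \o param (atlas i)) (coord (atlas i) p).

Definition change_of_basis (i j : idx) (p : M) : 'M[R]_m :=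
  jac (coord (atlas j)) i p.

Definition partial (V : normedModType R) (F : M -> V) (i : idx) (k : 'I_m)
  (p : M) : V := 'D_(delta_mx 0 k) (F \o param (atlas i)) (coord (atlas i) p).

Definition smooth_in_chart (V : normedModType R) (i : idx) (F : M -> V) : Prop :=
  smooth_on (cod (atlas i)) (F \o param (atlas i)).

Definition smooth (V : normedModType R) (F : M -> V) : Prop :=
  forall i, smooth_in_chart i F.

(* Vector fields and fields of endomorphisms are given by their components in
   the coordinate frame of each chart of the atlas; endomorphisms act on row
   vectors on the right. The components in chart i at a point outside the
   domain of chart i are irrelevant. *)
Definition vfield := idx -> M -> 'rV[R]_m.
Definition endofield := idx -> M -> 'M[R]_m.

Definition smooth_vfield (X : vfield) : Prop :=
  (forall i, smooth_in_chart i (X i)) /\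
  (forall i j p, dom (atlas i) p -> dom (atlas j) p ->
     X j p = X i p *m change_of_basis i j p).

Definition vfield_eq (X Y : vfield) : Prop :=
  forall i p, dom (atlas i) p -> X i p = Y i p.

Definition apply_endo (A : endofield) (X : vfield) : vfield :=
  fun i p => X i p *m A i p.

End Calculus.

Record riemannianManifold (R : realType) (m : nat) := RiemannianManifold {
  base :> orientedManifold R m;
  metric : atlas_index base -> base -> 'M[R]_m;
  metric_smooth : forall i, smooth_in_chart i (metric i);
  metric_sym : forall i p, dom (atlas i) p -> (metric i p)^T = metric i p;
  metric_pos : forall i p, dom (atlas i) p ->
    forall X : 'rV[R]_m, X != 0 -> 0 < (X *m metric i p *m X^T) 0 0;
  metric_compat : forall i j p, dom (atlas i) p -> dom (atlas j) p ->
    metric i p = change_of_basis i j p *m metric j p *m (change_of_basis i j p)^T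
}.

Section RiemannianGeometry.
Variables (R : realType) (m : nat) (M : riemannianManifold R m).
Local Notation idx := (atlas_index M).

Definition grad (f : M -> R) : vfield M :=
  fun i p => (\row_k partial (f : M -> R^o) i k p) *m invmx (metric i p).

Definition dmetric (i : idx) (p : M) (s k l : 'I_m) : R :=
  partial ((fun q => metric i q k l) : M -> R^o) i s p.

(* the Christoffel symbol Gamma^r_{kl} *)
Definition christoffel (i : idx) (p : M) (r k l : 'I_m) : R :=
  2^-1 * \sum_(s < m) invmx (metric i p) r s *
    (dmetric i p k l s + dmetric i p l k s - dmetric i p s k l).

Lemma metric_unit (i : idx) (p : M) : dom (atlas i) p -> metric i p \in unitmx.
Proof.
move=> ip; rewrite -row_free_unit -kermx_eq0; apply/negPn/negP => nz.
have := metric_pos ip; move/(_ (nz_row (kermx (metric i p)))).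
rewrite nz_row_eq0 => /(_ nz).
have /sub_kermxP -> := nz_row_sub (kermx (metric i p)).
by rewrite mul0mx mxE ltxx.
Qed.

Lemma dmetric_sym (i : idx) (p : M) s k l :
  dom (atlas i) p -> dmetric i p s k l = dmetric i p s l k.
Proof.
move=> ip; rewrite /dmetric /partial; apply: near_eq_derive.
have : nbhs (coord (atlas i) p) (coord (atlas i) @` dom (atlas i)).
  by apply: open_nbhs_nbhs; split; [exact: cod_open|exists p].
apply: filterS => _ [q iq <-] /=.
by rewrite coordK// -{1}(metric_sym iq) mxE.
Qed.

Lemma christoffel_sym (i : idx) (p : M) r k l :
  dom (atlas i) p -> christoffel i p r k l = christoffel i p r l k.
Proof.
move=> ip; rewrite /christoffel; congr (_ * _); apply: eq_bigr => s _.
by rewrite (dmetric_sym s k l ip) [dmetric i p k l s + _]addrC.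
Qed.

Lemma christoffel_metric (i : idx) (p : M) s k l : dom (atlas i) p ->
  dmetric i p s k l = \sum_r (christoffel i p r s k * metric i p r l +
                              christoffel i p r s l * metric i p r k).
Proof.
move=> ip.
have lower a b : \sum_r christoffel i p r s a * metric i p r b =
    2^-1 * (dmetric i p s a b + dmetric i p a s b - dmetric i p b s a).
  under eq_bigr do rewrite /christoffel -mulrA mulr_suml.
  rewrite -mulr_sumr; congr (_ * _); rewrite exchange_big /=.
  pose T t := dmetric i p s a t + dmetric i p a s t - dmetric i p t s a.
  transitivity (\sum_t (invmx (metric i p) *m metric i p) t b * T t).
    apply: eq_bigr => t _; rewrite mxE mulr_suml; apply: eq_bigr => r _.
    rewrite -/(T t) mulrAC; congr (_ * _ * _).
    have h : (invmx (metric i p))^T = invmx (metric i p).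
      by rewrite trmx_inv metric_sym.
    by rewrite -{1}h mxE.
  rewrite mulVmx ?metric_unit// (bigD1 b)//= mxE eqxx mul1r big1 ?addr0//.
  by move=> t /negPf tb; rewrite mxE tb mul0r.
rewrite big_split /= !lower (dmetric_sym s l k ip).
by field.
Qed.

(* the Levi-Civita connection; see [christoffel_sym] and [christoffel_metric] *)
Definition nabla (X Y : vfield M) : vfield M :=
  fun i p => \sum_(k < m) X i p 0 k *:
    (partial (Y i) i k p +
     \row_r \sum_(l < m) christoffel i p r k l * Y i p 0 l).

Definition nabla_endo (A : endofield M) (X Y : vfield M) : vfield M :=
  fun i p => nabla X (apply_endo A Y) i p - apply_endo A (nabla X Y) i p.

Definition parallel (A : endofield M) : Prop :=
  forall X Y : vfield M, smooth_vfield X -> smooth_vfield Y ->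
    vfield_eq (nabla_endo A X Y) (fun _ _ => 0).

(** * Hypersurfaces *)

Definition isometric_immersion (phi : M -> 'rV[R]_m.+1) : Prop :=
  [/\ smooth phi,
      forall i p, dom (atlas i) p -> row_free (jac phi i p)
    & forall i p, dom (atlas i) p -> forall X Y : 'rV[R]_m,
        (X *m metric i p *m Y^T) 0 0 = dot (X *m jac phi i p) (Y *m jac phi i p)].

Definition unit_normal (phi xi : M -> 'rV[R]_m.+1) : Prop :=
  [/\ smooth xi,
      forall p, dot (xi p) (xi p) = 1
    & forall i p, dom (atlas i) p -> forall X : 'rV[R]_m,
        dot (X *m jac phi i p) (xi p) = 0].

(* The Weingarten equation [d xi (X) = - d phi (A X)] (see [weingarten]) solved
   for A. *)
Definition shape_operator (phi xi : M -> 'rV[R]_m.+1) : endofield M :=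
  fun i p => - (jac xi i p *m (jac phi i p)^T *m invmx (metric i p)).

Lemma derive_dot (V : normedModType R) (n : nat) (F : V -> 'rV[R]_n) x v :
  differentiable F x ->
  'D_v (fun y => dot (F y) (F y) : R^o) x = 2 * dot ('D_v F x) (F x).
Proof.
move=> dF.
have dc j : is_derive x v (fun y => F y 0 j : R^o) ('D_v F x 0 j).
  have dj := differentiable_coord (F x) 0 j.
  have dFj : differentiable ((fun N : 'rV[R]_n => N 0 j : R^o) \o F) x.
    exact: differentiable_comp.
  apply: DeriveDef; first exact: diff_derivable.
  rewrite (_ : (fun y => _) = (fun N : 'rV[R]_n => N 0 j : R^o) \o F)//.
  rewrite deriveE// diff_comp//= deriveE//.
  have @f : {linear 'rV[R]_n -> R^o}.
    by exists (fun N : 'rV[R]_n => N 0 j); do 2![eexists]; do ?[constructor];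
      rewrite ?mxE// => ? *; rewrite ?mxE//; move=> ?; rewrite !mxE.
  rewrite (_ : (fun N : 'rV[R]_n => _) = f)// diff_lin//.
  exact: coord_continuous.
have -> : (fun y => dot (F y) (F y) : R^o) =
    \sum_(j < n) ((fun y => F y 0 j : R^o) * (fun y => F y 0 j : R^o)).
  by apply/funext => y; rewrite fct_sumE.
rewrite derive_sum; last by move=> j; exact: derivableM.
rewrite /dot mulr_sumr; apply: eq_bigr => j _.
rewrite deriveM// derive_val /GRing.scale/=; ring.
Qed.

Lemma dotE (n : nat) (u v : 'rV[R]_n) : dot u v = (u *m v^T) 0 0.
Proof. by rewrite mxE; apply: eq_bigr => j _; rewrite mxE. Qed.

Lemma weingarten (phi xi : M -> 'rV[R]_m.+1) (i : idx) (p : M) :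
  isometric_immersion phi -> unit_normal phi xi -> dom (atlas i) p ->
  jac xi i p = - (shape_operator phi xi i p *m jac phi i p).
Proof.
move=> [sphi frphi gphi] [sxi uxi nxi] ip.
have xi_tangent (X : 'rV[R]_m) : dot (X *m jac xi i p) (xi p) = 0.
  have dxi : differentiable (xi \o param (atlas i)) (coord (atlas i) p).
    by have [+ _] := sxi i 1%N; apply; exists p.
  have := derive_dot X dxi; rewrite deriveEjacobian//= coordK//.
  under eq_fun do rewrite uxi.
  by rewrite derive_cst => /esym/eqP; rewrite mulf_eq0 pnatr_eq0 => /eqP.
have g_jac : metric i p = jac phi i p *m (jac phi i p)^T.
  apply/matrixP => k l.
  have := gphi i p ip (delta_mx 0 k) (delta_mx 0 l).
  rewrite dotE trmx_mul !mulmxA -!(mulmxA (delta_mx 0 k)) -rowE => h.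
  by move: h; rewrite trmx_delta -rowE -!colE !mxE => ->.
apply/eqP; rewrite -addr_eq0; apply/eqP.
set B := _ + _.
have Bphi : B *m (jac phi i p)^T = 0.
  have alg (N D : 'M[R]_(m, m.+1)) (G : 'M[R]_m) : G \in unitmx ->
      G = D *m D^T -> (N + (- (N *m D^T *m invmx G)) *m D) *m D^T = 0.
    move=> uG GD; rewrite mulmxDl !mulNmx -(mulmxA _ D) -GD.
    by rewrite mulmxKV// subrr.
  exact: alg (metric_unit ip) g_jac.
have Bxi : B *m (xi p)^T = 0.
  apply/row_matrixP => k; rewrite row0 rowE mulmxA; apply/rowP => z.
  rewrite ord1 [RHS]mxE mulmxDr mulmxDl mxE -!dotE xi_tangent add0r.
  by rewrite mulmxA nxi.
pose Q := col_mx (jac phi i p) (xi p).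
have BQ : B *m Q^T = 0 by rewrite tr_col_mx mul_mx_row Bphi Bxi row_mx0.
have QQ : Q *m Q^T = block_mx (metric i p) 0 0 1%:M.
  rewrite tr_col_mx mul_col_row g_jac; congr block_mx.
  - apply/row_matrixP => k; rewrite row0 rowE mulmxA; apply/rowP => z.
    by rewrite ord1 [RHS]mxE -dotE nxi.
  - apply/trmx_inj; rewrite trmx_mul trmxK trmx0.
    apply/row_matrixP => k; rewrite row0 rowE mulmxA; apply/rowP => z.
    by rewrite ord1 [RHS]mxE -dotE nxi.
  - by apply/matrixP => a b; rewrite !ord1 -dotE uxi mxE.
have rQ : row_free Q^T.
  have rk : \rank (Q *m Q^T) = (m + 1)%N.
    rewrite QQ mxrank_unit// unitmxE det_ublock det1 mulr1 -unitmxE.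
    exact: metric_unit.
  rewrite /row_free mxrank_tr eqn_leq rank_leq_col /=.
  by apply: leq_trans (mxrankM_maxl Q Q^T); rewrite rk addn1.
by apply/eqP; rewrite -(mulmx_free_eq0 B rQ) BQ.
Qed.

(* Traces do not depend on the chart; [chart_at p] is just one around p. *)
Definition mean_curvature (phi xi : M -> 'rV[R]_m.+1) (p : M) : R :=
  (m%:R)^-1 * \tr (shape_operator phi xi (chart_at p) p).

Definition shape_sqnorm (phi xi : M -> 'rV[R]_m.+1) (p : M) : R :=
  let A := shape_operator phi xi (chart_at p) p in \tr (A *m A).

Definition non_minimal (phi xi : M -> 'rV[R]_m.+1) : Prop :=
  exists p, mean_curvature phi xi p != 0.

Definition biconservative (phi xi : M -> 'rV[R]_m.+1) : Prop :=
  let f := mean_curvature phi xi in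
  vfield_eq (apply_endo (shape_operator phi xi) (grad f))
            (fun i p => (- (m%:R / 2) * f p) *: grad f i p).

End RiemannianGeometry.

(* Main.v *)
Require Import Defs.
From HB Require Import structures.
From mathcomp Require Import all_boot all_order all_algebra.
From mathcomp Require Import all_classical all_reals all_analysis.
From mathcomp Require Import perm ring lra.

(** Let [h] be the second fundamental form with respect to [xi], extended by zero
    in the normal direction to a field of symmetric matrices of the ambient space,
    and [H = tr h = m f].

    The bound [|h|^2 <= H^2 / (m - 1)] makes [H h] positive semidefinite
    ([pinched_semidefinite]): if [a] is the value of [h] on a unit tangent vector,
    then [a^2 + (H - a)^2 / (m - 1) <= |h|^2] by the Cauchy-Schwarz inequality, so
    that [m a^2 <= 2 H a]. A nonzero gradient of [f] would be a principal direction
    of curvature [- m f / 2], of sign opposite to that of [H]. Hence [f] is locally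
    constant where it does not vanish and, [M] being connected, it is a nonzero
    constant ([mean_curvature_cst]).

    For constant [H] the Simons identity ([simons]) reads
      [Delta |h|^2 / 2 = |nabla h|^2 + H tr h^3 - |h|^4].
    The last two terms add up to [H tr (h (h - tau)^2)], [tau = |h|^2 / H], which
    is nonnegative because [H h] is semidefinite ([pinched_cubic]). So [|h|^2] is
    subharmonic, hence constant on the compact [M] by the strong maximum principle
    ([subharmonic_cst]), and [tr (h (h - tau)^2) = 0]. At a point of [M] farthest
    from the origin [h] is definite on the tangent space, so [h] is there a
    multiple of the identity and [|h|^2 = H^2 / m]. As [|h|^2] is constant, this
    holds everywhere and [M] is umbilic ([umbilic]). Then [A] is [f] times the
    identity, [xi + f phi] is constant, and [phi] takes its values in a sphere of
    radius [1 / |f|], all of which is reached because height functions attain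
    their maxima ([umbilic_sphere]).

    The proof integrates nothing and takes no covariant derivative of tensors. The
    strong maximum principle is Hopf's argument in a chart ([strong_maximum]).
    Derivatives are taken along the tangential parts of the vectors of the standard
    basis of the ambient space. These [d_a] are derivations of the ring of smooth
    functions on [M], in which the components [x_a], [nu_a] of [phi] and [xi] and
    the entries [h_ab = - d_a nu_b] live, and the Simons identity is algebra in
    that ring, from the commutation rule
      [d_a d_b - d_b d_a = \sum_c (nu_b h_ac - nu_a h_bc) d_c]
    ([bracket_form]). *)

Set Implicit Arguments.
Unset Strict Implicit.
Unset Printing Implicit Defensive.
Import Order.TTheory GRing.Theory Num.Theory.
Import numFieldNormedType.Exports.
Local Open Scope classical_set_scope.
Local Open Scope ring_scope.

Local Notation coord := Defs.coord.

(** * Smooth functions on open sets *)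

Section SmoothOnOpen.
Variables (R : realType) (V : normedModType R).

Lemma near_eq_differentiable (W : normedModType R) (f g : V -> W) (x : V) :
  (\near x, f x = g x) -> differentiable f x -> differentiable g x.
Proof.
move=> fg df.
have gfx : g x = f x by rewrite (nbhs_singleton fg).
have gE : g \o shift x = cst (g x) + ('d f x : V -> W) +o_ 0 id.
  apply/eqaddoP => _/posnumP[e].
  have /eqaddoP/(_ e%:num) := diff_locally df.
  move=> /(_ ltac:(done)) h.
  have fg0 : \forall y \near 0, f (y + x) = g (y + x).
    by move: fg; rewrite (near_shift 0); apply: filterS => y /=; rewrite subr0.
  near=> y; have -> : (g \o shift x - (cst (g x) + ('d f x : V -> W))) y =
    (f \o shift x - (cst (f x) + ('d f x : V -> W))) y.
    by rewrite !fctE /= gfx (near fg0).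
  by near: y.
have dgf := diff_unique (diff_continuous df) gE.
by apply/diff_locallyP; rewrite dgf; split => //; exact: diff_continuous.
Unshelve. all: by end_near. Qed.

Variable (D : set V).
Hypothesis oD : open D.

Lemma near_open x : D x -> \forall y \near x, D y.
Proof. by move=> Dx; exact: open_nbhs_nbhs. Qed.

Lemma near_eq_on (W : Type) (f g : V -> W) x :
  (forall y, D y -> f y = g y) -> D x -> \forall y \near x, f y = g y.
Proof. by move=> fg /near_open; apply: filterS => y /fg. Qed.

Lemma eq_on_derive (W : normedModType R) (f g : V -> W) v x :
  (forall y, D y -> f y = g y) -> D x -> 'D_v f x = 'D_v g x.
Proof. by move=> fg Dx; apply: near_eq_derive; exact: near_eq_on. Qed.

Lemma eq_on_Cn (W : normedModType R) k (f g : V -> W) :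
  (forall y, D y -> f y = g y) -> Cn_on k D f -> Cn_on k D g.
Proof.
elim: k f g => [|k IH] f g fg /=.
  move=> cf x Dx; rewrite /prop_for /continuous_at -(fg x)//.
  by apply: cvg_trans (cf x Dx); apply: near_eq_cvg; exact: near_eq_on.
move=> [df Cf]; split=> [x Dx|v].
  by apply: near_eq_differentiable (df _ Dx); exact: near_eq_on.
by apply: IH (Cf v) => y Dy; exact: eq_on_derive.
Qed.

Lemma eq_on_smooth (W : normedModType R) (f g : V -> W) :
  (forall y, D y -> f y = g y) -> smooth_on D f -> smooth_on D g.
Proof. by move=> fg sf k; exact: eq_on_Cn (sf k). Qed.

Lemma CnW (W : normedModType R) k (f : V -> W) : Cn_on k.+1 D f -> Cn_on k D f.
Proof.
elim: k f => [|k IH] f /= [df Cf].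
  by move=> x Dx; exact: differentiable_continuous (df x Dx).
by split=> // v; apply: IH.
Qed.

Lemma smooth_differentiable (W : normedModType R) (f : V -> W) x :
  smooth_on D f -> D x -> differentiable f x.
Proof. by move=> /(_ 1%N)[+ _]; apply. Qed.

Lemma smooth_derivable (W : normedModType R) (f : V -> W) x v :
  smooth_on D f -> D x -> derivable f x v.
Proof. by move=> sf Dx; exact/diff_derivable/smooth_differentiable. Qed.

Lemma smooth_continuous (W : normedModType R) (f : V -> W) x :
  smooth_on D f -> D x -> {for x, continuous f}.
Proof. by move=> /(_ 0); apply. Qed.

Lemma smooth_near_dist (u : V -> R^o) x (e : R) :
  smooth_on D u -> D x -> 0 < e -> \forall y \near x, `|u x - u y| < e.
Proof.
move=> su Dx; have cu := smooth_continuous su Dx.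
exact: (@cvgr_dist_lt _ R^o _ _ _ u (u x) cu).
Qed.

Lemma smooth_near_gt (u : V -> R^o) x (c : R) :
  smooth_on D u -> D x -> c < u x -> \forall y \near x, c < u y.
Proof.
move=> su Dx; have cu := smooth_continuous su Dx.
exact: (@cvgr_gt _ _ _ _ u (u x) cu).
Qed.

Lemma smooth_derive (W : normedModType R) (f : V -> W) v :
  smooth_on D f -> smooth_on D (fun x => 'D_v f x).
Proof. by move=> sf k; case: (sf k.+1) => _; apply. Qed.

Lemma smooth_cst (W : normedModType R) (c : W) : smooth_on D (cst c).
Proof.
move=> k; elim: k c => [|k IH] c; first by move=> x _; exact: cst_continuous.
split=> [x _|v]; first exact: differentiable_cst.
by rewrite (_ : (fun x => _) = cst 0)//; apply/funext => x; rewrite derive_cst.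
Qed.

Lemma CnD (W : normedModType R) k (f g : V -> W) :
  Cn_on k D f -> Cn_on k D g -> Cn_on k D (f + g).
Proof.
elim: k f g => [|k IH] f g /=.
  by move=> cf cg x Dx; apply: continuousD; [exact: cf|exact: cg].
move=> [df Cf] [dg Cg]; split=> [x Dx|v].
  by apply: differentiableD; [exact: df|exact: dg].
apply: eq_on_Cn (IH _ _ (Cf v) (Cg v)) => y Dy.
by rewrite deriveD//; [exact/diff_derivable/df|exact/diff_derivable/dg].
Qed.

Lemma smoothD (W : normedModType R) (f g : V -> W) :
  smooth_on D f -> smooth_on D g -> smooth_on D (f + g).
Proof. by move=> sf sg k; exact: CnD. Qed.

Implicit Types u w : V -> R^o.

Lemma CnM k u w : Cn_on k D u -> Cn_on k D w -> Cn_on k D (u * w).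
Proof.
elim: k u w => [|k IH] u w.
  by move=> cu cw x Dx; apply: continuousM; [exact: cu|exact: cw].
move=> Cu Cw; have Cu0 := CnW Cu; have Cw0 := CnW Cw.
move: Cu Cw => [du Cu] [dw Cw]; split=> [x Dx|v].
  by apply: differentiableM; [exact: du|exact: dw].
apply: eq_on_Cn (CnD (IH _ _ Cu0 (Cw v)) (IH _ _ Cw0 (Cu v))) => y Dy.
by rewrite deriveM//; [exact/diff_derivable/du|exact/diff_derivable/dw].
Qed.

Lemma smoothM u w : smooth_on D u -> smooth_on D w -> smooth_on D (u * w).
Proof. by move=> su sw k; exact: CnM. Qed.

Lemma smooth_sum (I : Type) (r : seq I) (P : pred I) (f : I -> V -> R^o) :
  (forall i, P i -> smooth_on D (f i)) -> smooth_on D (\sum_(i <- r | P i) f i).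
Proof.
move=> sf; elim/big_ind: _ => //; first exact: smooth_cst.
exact: smoothD.
Qed.

Lemma smooth_prod (I : Type) (r : seq I) (P : pred I) (f : I -> V -> R^o) :
  (forall i, P i -> smooth_on D (f i)) -> smooth_on D (\prod_(i <- r | P i) f i).
Proof.
move=> sf; elim/big_ind: _ => //; first exact: smooth_cst.
exact: smoothM.
Qed.

Lemma smoothN u : smooth_on D u -> smooth_on D (- u).
Proof.
move=> su; rewrite (_ : - u = cst (-1) * u); last first.
  by apply/funext => x; rewrite fctE /= mulN1r.
exact: smoothM (smooth_cst _) su.
Qed.

Lemma smoothV u : (forall x, D x -> u x != 0) ->
  smooth_on D u -> smooth_on D (fun x => (u x)^-1 : R^o).
Proof.
move=> u0 su k; elim: k => [|k IH].
  by move=> x Dx; apply: continuousV; [exact: u0|exact: smooth_continuous Dx].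
split=> [x Dx|v].
  exact: differentiableV (smooth_differentiable su Dx) (u0 _ Dx).
apply: eq_on_Cn (CnM (CnM IH IH) (smoothN (smooth_derive v su) k)) => y Dy.
rewrite deriveV ?u0//; last exact: smooth_derivable Dy.
by rewrite !fctE /= /GRing.scale/= mulrN mulNr -invfM expr2.
Qed.

Lemma smooth_entry p q (F : V -> 'M[R]_(p, q)) i j :
  smooth_on D F -> smooth_on D (fun x => F x i j : R^o).
Proof.
move=> sF k; elim: k F sF => [|k IH] F sF.
  move=> x Dx; apply: (@continuous_comp _ _ _ F (fun M : 'M[R]_(p, q) => M i j)).
    exact: smooth_continuous Dx.
  exact: coord_continuous.
split=> [x Dx|v].
  apply: (@differentiable_comp _ _ _ _ F (fun M : 'M[R]_(p, q) => M i j : R^o)).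
    exact: smooth_differentiable Dx.
  exact: differentiable_coord.
apply: eq_on_Cn (IH _ (smooth_derive v sF)) => y Dy.
by rewrite derive_mx ?mxE//; exact: smooth_derivable Dy.
Qed.

Lemma derive_entry p q (F : V -> 'M[R]_(p, q)) i j x v :
  smooth_on D F -> D x -> 'D_v (fun x => F x i j : R^o) x = 'D_v F x i j.
Proof. by move=> sF Dx; rewrite derive_mx ?mxE//; exact: smooth_derivable Dx. Qed.

End SmoothOnOpen.

(** * Mixed derivatives and local maxima *)

Section Lines.
Variables (R : realType) (V : normedModType R).
Implicit Types (f : V -> R^o) (x y v w : V).

Lemma is_derive_line f y v (s : R) : derivable f (y + s *: v) v ->
  is_derive s 1 (fun t : R => f (y + t *: v) : R^o) ('D_v f (y + s *: v)).
Proof.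
have E : (fun h : R => h^-1 *: (f (y + (h *: (1 : R) + s) *: v) - f (y + s *: v)))
     = (fun h : R => h^-1 *: (f (h *: v + (y + s *: v)) - f (y + s *: v))).
  apply/funext => h; rewrite [h *: 1]mulr1 scalerDl [_ *: v + _ *: v]addrC addrA.
  by rewrite [_ + h *: v]addrC.
move=> dl; apply: DeriveDef; first by rewrite /derivable E.
by rewrite /derive E.
Qed.

Lemma line_MVT f y v (s : R) : 0 < s ->
  (forall t, 0 <= t <= s -> derivable f (y + t *: v) v) ->
  exists2 c, 0 < c < s & f (y + s *: v) - f y = s * 'D_v f (y + c *: v).
Proof.
move=> s0 df.
have [] := @MVT R (fun t => f (y + t *: v)) (fun t => 'D_v f (y + t *: v)) 0 s s0.
- move=> t; rewrite in_itv/= => /andP[/ltW t0 /ltW ts].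
  by apply: is_derive_line; apply: df; rewrite t0.
- apply: derivable_within_continuous => t; rewrite in_itv/= => /df dft.
  by have [] := is_derive_line dft.
move=> c; rewrite in_itv/= => c0s; rewrite scale0r addr0 subr0 mulrC => E.
by exists c.
Qed.

Variable (D : set V).
Hypothesis oD : open D.

(** Two applications of the mean value theorem, along [v] and then along [w]. *)
Lemma second_difference f x v w (s : R) : 0 < s -> smooth_on D f ->
  (forall a b, 0 <= a <= s -> 0 <= b <= s -> D (x + a *: v + b *: w)) ->
  exists a b, [/\ 0 < a < s, 0 < b < s &
   f (x + s *: v + s *: w) - f (x + s *: v) - f (x + s *: w) + f x =
   s * (s * 'D_w (fun y => 'D_v f y : R^o) (x + a *: v + b *: w))].
Proof.
move=> s0 sf inD.
have ss : 0 <= s <= s by rewrite lexx ltW.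
have s00 : 0 <= (0 : R) <= s by rewrite lexx ltW.
pose G : V -> R^o := (f \o shift (s *: w)) - f.
have sG t : 0 <= t <= s -> is_derive (x + t *: v) v G
    ('D_v f (x + t *: v + s *: w) - 'D_v f (x + t *: v)).
  move=> t0s; apply: is_deriveB; last first.
    apply: DeriveDef => //; apply: smooth_derivable sf _ => //.
    by have := inD t 0 t0s s00; rewrite scale0r addr0.
  have E y : (fun h : R => h^-1 *: ((f \o shift (s *: w)) (h *: v + y) -
             (f \o shift (s *: w)) y)) =
         (fun h : R => h^-1 *: (f (h *: v + (y + s *: w)) - f (y + s *: w))).
    by apply/funext => h /=; rewrite addrA.
  apply: DeriveDef; last by rewrite /derive E.
  by rewrite /derivable E; apply: smooth_derivable sf _ => //; exact: inD.
have [|a a0s Ga] := @line_MVT G x v s s0.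
  by move=> t t0s; have [] := sG t t0s.
have {}a0s' : 0 <= a <= s by case/andP: a0s => /ltW -> /ltW.
have [|b b0s Gb] := @line_MVT (fun y => 'D_v f y : R^o) (x + a *: v) w s s0.
  by move=> t t0s; apply: smooth_derivable (smooth_derive v sf) _; exact: inD.
exists a, b; split=> //; rewrite -Gb; have [_ <-] := sG a a0s'.
by rewrite -Ga /G !fctE /=; ring.
Qed.

Lemma small_step x v w (e : R) : 0 < e -> exists2 s : R, 0 < s &
  forall a b, 0 <= a <= s -> 0 <= b <= s -> ball x e (x + a *: v + b *: w).
Proof.
move=> e0; have N0 : 0 < `|v| + `|w| + 1 by rewrite ltr_wpDl// addr_ge0.
exists (e / 2 / (`|v| + `|w| + 1)); first by rewrite !divr_gt0.
set s := _ / _ => a b /andP[a0 ls] /andP[b0 lb].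
rewrite -ball_normE /ball_ /= -addrA opprD addNKr normrN.
apply: (@le_lt_trans _ _ (s * (`|v| + `|w| + 1))).
  rewrite (le_trans (ler_normD _ _))// !normrZ !ger0_norm//.
  rewrite (@le_trans _ _ (s * `|v| + s * `|w|))//.
    by rewrite lerD// ler_wpM2r.
  by rewrite -mulrDr ler_wpM2l ?lerDl// (le_trans a0).
by rewrite /s divfK ?gt_eqF// ltr_pdivrMr// ltr_pMr// ltr1n.
Qed.

(** Both mixed derivatives are limits of the same second difference. *)
Lemma derive_comm f x v w : smooth_on D f -> D x ->
  'D_v (fun y => 'D_w f y : R^o) x = 'D_w (fun y => 'D_v f y : R^o) x.
Proof.
move=> sf Dx.
pose A := (fun y => 'D_v (fun y => 'D_w f y : R^o) y) : V -> R^o.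
pose B := (fun y => 'D_w (fun y => 'D_v f y : R^o) y) : V -> R^o.
apply/eqP; rewrite -subr_eq0 -normr_eq0 -[_ == 0]negbK -normr_gt0 normr_id.
apply/negP => AB; pose e := `|A x - B x|.
have e2 : 0 < e / 2 by rewrite divr_gt0.
have sA : smooth_on D A by do 2!apply: smooth_derive.
have sB : smooth_on D B by do 2!apply: smooth_derive.
have cA : \forall y \near x, `|A x - A y| < e / 2.
  exact: smooth_near_dist sA Dx e2.
have cB : \forall y \near x, `|B x - B y| < e / 2.
  exact: smooth_near_dist sB Dx e2.
have : \forall y \near x, [/\ D y, `|A x - A y| < e / 2 & `|B x - B y| < e / 2].
  by apply: filterS (filterI (near_open oD Dx) (filterI cA cB)) => y [? []].
move=> /nbhs_ballP[r r0 rP].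
have [s s0 sP] := small_step x v w r0.
have [|a [b [a0 b0 E1]]] := @second_difference f x v w s s0 sf.
  by move=> a b /sP/[apply]/rP[].
have [|a' [b' [a0' b0' E2]]] := @second_difference f x w v s s0 sf.
  by move=> c d hc hd; rewrite addrAC; have [] := rP _ (sP d c hd hc).
have W t : 0 < t < s -> 0 <= t <= s by case/andP=> /ltW -> /ltW.
have [_ _ hB] := rP _ (sP a b (W _ a0) (W _ b0)).
have [_ hA _] := rP _ (sP b' a' (W _ b0') (W _ a0')).
have AB' : A (x + b' *: v + a' *: w) = B (x + a *: v + b *: w).
  apply: (mulfI (lt0r_neq0 s0)); apply: (mulfI (lt0r_neq0 s0)).
  rewrite [x + b' *: v + _]addrAC; apply: etrans (esym E2) (etrans _ E1).
  by rewrite [x + s *: w + _]addrAC [X in X + _]addrAC.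
move: AB' hA hB; rewrite /e; move: (A (_ + _)) (B (_ + _)) (A x) (B x).
move=> p q a1 b1 -> hA hB; have := ler_distD q a1 b1; rewrite leNgt => /negP; apply.
by rewrite (splitr `|a1 - b1|) ltrD// distrC.
Qed.

Lemma small_segment f x v : (\forall y \near x, f y <= f x) -> D x ->
  exists2 s : R, 0 < s & forall t, `|t| <= s ->
    f (x + t *: v) <= f x /\ D (x + t *: v).
Proof.
move=> fm Dx; have : \forall y \near x, f y <= f x /\ D y.
  by apply: filterS (filterI fm (near_open oD Dx)).
move=> /nbhs_ballP[r r0 rP].
have [s s0 sP] := small_step x v (- v) r0.
exists s => // t; rewrite ler_norml => /andP[st ts]; apply: rP.
have [t0|t0] := leP 0 t.
  have := sP t 0; rewrite scale0r addr0 t0 ts; apply=> //.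
  by rewrite lexx ltW.
have := sP 0 (- t); rewrite scale0r addr0 scalerN scaleNr opprK; apply.
  by rewrite lexx ltW.
by rewrite oppr_ge0 ltW//= lerNl.
Qed.

Lemma derive_at_max f x v : smooth_on D f -> D x ->
  (\forall y \near x, f y <= f x) -> 'D_v f x = 0.
Proof.
move=> sf Dx fm; have [s s0 sP] := small_segment v fm Dx.
have ns t : t \in `]- s, s[ -> `|t| <= s.
  by rewrite in_itv/= ler_norml => /andP[/ltW -> /ltW ->].
have dl t : D (x + t *: v) ->
    is_derive t 1 (fun t : R => f (x + t *: v) : R^o) ('D_v f (x + t *: v)).
  by move=> Dt; apply: is_derive_line; exact: smooth_derivable Dt.
have [] := @derive1_at_max R (fun t => f (x + t *: v)) (- s) s 0.
- by rewrite (@le_trans _ _ 0)// ?oppr_le0 ltW.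
- by move=> t /ns/sP[_ /dl[]].
- by rewrite in_itv/= oppr_lt0 s0.
- by move=> t /ns/sP[+ _]; rewrite scale0r addr0.
move=> _; have := dl 0; rewrite scale0r addr0 => /(_ Dx)[_ <-].
by [].
Qed.

(** Were the second derivative positive, two applications of the mean value
    theorem would give larger values of [f] just beside [x]. *)
Lemma derive2_at_max f x v : smooth_on D f -> D x ->
  (\forall y \near x, f y <= f x) -> 'D_v (fun y => 'D_v f y : R^o) x <= 0.
Proof.
move=> sf Dx fm; rewrite leNgt; apply/negP => pos.
have s1 : smooth_on D (fun y => 'D_v f y : R^o) by exact: smooth_derive.
have s2 : smooth_on D (fun y => 'D_v (fun y => 'D_v f y : R^o) y : R^o).
  exact: smooth_derive.
have : \forall y \near x, [/\ f y <= f x, D y &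
    0 < 'D_v (fun y => 'D_v f y : R^o) y].
  have pn := smooth_near_gt s2 Dx pos.
  by apply: filterS (filterI fm (filterI (near_open oD Dx) pn)) => y [? []].
move=> /nbhs_ballP[r r0 rP]; have [s s0 sP] := small_step x v 0 r0.
have inB t : 0 <= t <= s -> [/\ f (x + t *: v) <= f x, D (x + t *: v) &
    0 < 'D_v (fun y => 'D_v f y : R^o) (x + t *: v)].
  move=> ts; have := sP t t ts ts; rewrite scaler0 addr0; exact: rP.
have [t ts|c /andP[c0 cs]] := @line_MVT f x v s s0.
  by have [_ ? _] := inB t ts; exact: smooth_derivable.
have [t /andP[t0 tc]|d /andP[d0 dc]] :=
    @line_MVT (fun y => 'D_v f y : R^o) x v c c0.
  by have [|_ ? _] := inB t; [rewrite t0 (le_trans tc)// ltW|exact: smooth_derivable].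
rewrite (derive_at_max v sf Dx fm) subr0 => -> E.
have [|_ _ D2] := inB d; first by rewrite ltW//= ltW// (lt_trans dc).
have [|F _ _] := inB s; first by rewrite lexx ltW.
have : 0 < f (x + s *: v) - f x by rewrite E !mulr_gt0.
by rewrite subr_gt0 ltNge F.
Qed.

End Lines.

(** * Vector fields *)

Section DotProduct.
Variables (R : realType) (n : nat).
Implicit Types u v w : 'rV[R]_n.

Lemma dotC u v : dot u v = dot v u.
Proof. by apply: eq_bigr => i _; rewrite mulrC. Qed.

Lemma dotDl u v w : dot (u + v) w = dot u w + dot v w.
Proof. by rewrite /dot -big_split; apply: eq_bigr => i _; rewrite mxE mulrDl. Qed.

Lemma dotDr u v w : dot w (u + v) = dot w u + dot w v.
Proof. by rewrite dotC dotDl !(dotC w). Qed.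

Lemma dotZl a u v : dot (a *: u) v = a * dot u v.
Proof. by rewrite /dot mulr_sumr; apply: eq_bigr => i _; rewrite mxE mulrA. Qed.

Lemma dotZr a u v : dot v (a *: u) = a * dot v u.
Proof. by rewrite dotC dotZl dotC. Qed.

Lemma dotNl u v : dot (- u) v = - dot u v.
Proof. by rewrite -scaleN1r dotZl mulN1r. Qed.

Lemma dotNr u v : dot v (- u) = - dot v u.
Proof. by rewrite dotC dotNl dotC. Qed.

Lemma dot_ge0 u : 0 <= dot u u.
Proof. by apply: sumr_ge0 => i _; rewrite -expr2 sqr_ge0. Qed.

Lemma dot_eq0 u : (dot u u == 0) = (u == 0).
Proof.
apply/eqP/eqP => [/eqP|->]; last by rewrite /dot big1// => i _; rewrite mxE mul0r.
rewrite psumr_eq0; last by move=> i _; rewrite -expr2 sqr_ge0.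
move=> /allP h; apply/rowP => i; have := h i (mem_index_enum _).
by rewrite mulf_eq0 orbb mxE => /eqP.
Qed.

Lemma normr_lt_dot u (s : R) : 0 < s -> dot u u < s ^+ 2 -> `|u| < s.
Proof.
move=> s0 us; rewrite /Num.Def.normr/= mx_normrE bigmax_lt// => -[i j] _ /=.
rewrite (ord1 i); have : `|u 0 j| ^+ 2 < s ^+ 2.
  rewrite real_normK ?num_real//; apply: le_lt_trans us.
  rewrite /dot (bigD1 j)//= expr2 lerDl.
  by apply: sumr_ge0 => k _; rewrite -expr2 sqr_ge0.
by rewrite ltr_pXn2r ?nnegrE// ltW.
Qed.

End DotProduct.

Section VectorFields.
Variables (R : realType) (m : nat).
Local Notation V := 'rV[R]_m.
Variable D : set V.
Hypothesis oD : open D.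
Implicit Types (u w : V -> R^o) (X : V -> V).

Definition smooth_vect X := forall k, smooth_on D (fun x => X x 0 k : R^o).

Definition vderiv X u : V -> R^o := fun x => 'D_(X x) u x.

Lemma smooth_id : smooth_on D (@id V).
Proof.
case=> [|k]; first by move=> x _; exact: cvg_id.
split=> [x _|v]; first exact: ex_diff.
apply: (eq_on_Cn oD) (smooth_cst D v k) => x _.
by rewrite derive_id.
Qed.

Lemma derive_coordE u x v : differentiable u x ->
  'D_v u x = \sum_k v 0 k * 'D_(delta_mx 0 k) u x.
Proof.
move=> du; rewrite deriveE// {1}(row_sum_delta v) linear_sum; apply: eq_bigr => k _.
by rewrite linearZ /= deriveE.
Qed.

Lemma vderivE X u x : smooth_on D u -> D x ->
  vderiv X u x = \sum_k X x 0 k * 'D_(delta_mx 0 k) u x.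
Proof. by move=> su Dx; apply: derive_coordE; exact: smooth_differentiable Dx. Qed.

Lemma smooth_vderiv X u : smooth_vect X -> smooth_on D u ->
  smooth_on D (vderiv X u).
Proof.
move=> sX su; apply: (@eq_on_smooth _ _ _ oD _
  (\sum_k (fun x => X x 0 k : R^o) * (fun x => 'D_(delta_mx 0 k) u x : R^o))).
  by move=> x Dx; rewrite (vderivE X su Dx) fct_sumE.
apply: smooth_sum => // k _; apply: smoothM => //; exact: smooth_derive.
Qed.

Lemma vderivD X u w x : smooth_on D u -> smooth_on D w -> D x ->
  vderiv X (u + w) x = vderiv X u x + vderiv X w x.
Proof.
by move=> su sw Dx; rewrite /vderiv deriveD//;
  [exact: smooth_derivable su Dx|exact: smooth_derivable sw Dx].
Qed.

Lemma vderivM X u w x : smooth_on D u -> smooth_on D w -> D x ->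
  vderiv X (u * w) x = u x * vderiv X w x + w x * vderiv X u x.
Proof.
by move=> su sw Dx; rewrite /vderiv deriveM//;
  [exact: smooth_derivable su Dx|exact: smooth_derivable sw Dx].
Qed.

Lemma vderiv_cst X c x : vderiv X (cst c) x = 0.
Proof. by rewrite /vderiv derive_cst. Qed.

Lemma eq_on_vderiv X u w x : (forall y, D y -> u y = w y) -> D x ->
  vderiv X u x = vderiv X w x.
Proof. by move=> uw Dx; exact: (eq_on_derive oD). Qed.

Lemma vderivZ X (c : R) u x : smooth_on D u -> D x ->
  vderiv X (cst c * u) x = c * vderiv X u x.
Proof.
move=> su Dx; rewrite vderivM//; last exact: smooth_cst.
by rewrite vderiv_cst mulr0 addr0.
Qed.

Lemma vderiv2D X u w x : smooth_vect X -> smooth_on D u -> smooth_on D w ->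
  D x -> vderiv X (vderiv X (u + w)) x =
         vderiv X (vderiv X u) x + vderiv X (vderiv X w) x.
Proof.
move=> sX su sw Dx; rewrite -vderivD//; try exact: smooth_vderiv.
by apply: eq_on_vderiv => // y Dy; rewrite vderivD.
Qed.

Lemma vderiv2Z X (c : R) u x : smooth_vect X -> smooth_on D u -> D x ->
  vderiv X (vderiv X (cst c * u)) x = c * vderiv X (vderiv X u) x.
Proof.
move=> sX su Dx; rewrite -vderivZ//; last exact: smooth_vderiv.
by apply: eq_on_vderiv => // y Dy; rewrite vderivZ.
Qed.

Lemma vderiv2_sqr X u x : smooth_vect X -> smooth_on D u -> D x ->
  vderiv X (vderiv X (u * u)) x =
  2 * u x * vderiv X (vderiv X u) x + 2 * vderiv X u x ^+ 2.
Proof.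
move=> sX su Dx; have sXu := smooth_vderiv sX su.
have E : vderiv X (vderiv X (u * u)) x =
  vderiv X (u * vderiv X u + u * vderiv X u) x.
  by apply: eq_on_vderiv => // y Dy; rewrite vderivM.
rewrite E vderivD//; try exact: smoothM.
by rewrite vderivM//; ring.
Qed.

(** At a critical point the derivatives of the coefficients of [X] drop out. *)
Lemma vderiv2_at_max X u x : smooth_vect X -> smooth_on D u -> D x ->
  (\forall y \near x, u y <= u x) -> vderiv X (vderiv X u) x <= 0.
Proof.
move=> sX su Dx ux; have := derive2_at_max oD (X x) su Dx ux.
suff -> : vderiv X (vderiv X u) x = 'D_(X x) (fun y => 'D_(X x) u y : R^o) x by [].
pose d k : V -> R^o := fun y => 'D_(delta_mx 0 k) u y.
have sd k : smooth_on D (d k) by exact: smooth_derive.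
have -> : vderiv X (vderiv X u) x =
    'D_(X x) (\sum_k (fun y => X y 0 k : R^o) * d k) x.
  by apply: (eq_on_derive oD) => // y Dy; rewrite (vderivE X su Dy) fct_sumE.
have -> : 'D_(X x) (fun y => 'D_(X x) u y : R^o) x =
    'D_(X x) (\sum_k (cst (X x 0 k) : V -> R^o) * d k) x.
  apply: (eq_on_derive oD) => // y Dy; rewrite fct_sumE.
  by rewrite (derive_coordE _ (smooth_differentiable su Dy)).
rewrite !derive_sum; first last.
- by move=> k; apply: smooth_derivable Dx; apply: smoothM.
- by move=> k; apply: smooth_derivable Dx; apply: smoothM => //; exact: smooth_cst.
apply: eq_bigr => k _; rewrite !deriveM; try by apply: smooth_derivable Dx.
  by rewrite derive_cst /d (derive_at_max oD _ su Dx ux) !scale0r.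
by apply: smooth_derivable Dx; exact: smooth_cst.
Qed.

(** Second derivatives commute, so the bracket is a first order operator. *)
Lemma vderiv_bracket X Y x : smooth_vect X -> smooth_vect Y -> D x ->
  exists Z : V, forall u, smooth_on D u ->
    vderiv X (vderiv Y u) x - vderiv Y (vderiv X u) x = 'D_Z u x.
Proof.
move=> sX sY Dx.
exists (\row_k ('D_(X x) (fun y => Y y 0 k : R^o) x -
               'D_(Y x) (fun y => X y 0 k : R^o) x)) => u su.
have [g gE] : exists g : 'I_m -> V -> R^o,
    forall k y, g k y = 'D_(delta_mx 0 k) u y by exists (fun k => 'D_(delta_mx 0 k) u).
have sg k : smooth_on D (g k).
  by have -> : g k = (fun y => 'D_(delta_mx 0 k) u y);
    [apply/funext => y; exact: gE|exact: smooth_derive].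
have gC k l : 'D_(delta_mx 0 l) (g k) x = 'D_(delta_mx 0 k) (g l) x.
  have gf j : g j = (fun y => 'D_(delta_mx 0 j) u y) by apply/funext => y; exact: gE.
  by rewrite !gf (derive_comm oD _ _ su Dx).
have E A B : smooth_vect B -> vderiv A (vderiv B u) x =
    \sum_k B x 0 k * 'D_(A x) (g k) x +
    \sum_k g k x * 'D_(A x) (fun y => B y 0 k : R^o) x.
  move=> sB; have -> : vderiv A (vderiv B u) x = vderiv A
     (\sum_k (fun y => B y 0 k : R^o) * g k) x.
    apply: eq_on_vderiv => // y Dy; rewrite (vderivE B su Dy) fct_sumE.
    by apply: eq_bigr => k _; rewrite -gE.
  rewrite /vderiv derive_sum; last first.
    by move=> k; apply: smooth_derivable Dx; exact: smoothM.
  rewrite -big_split /=; apply: eq_bigr => k _.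
  by rewrite deriveM//; apply: smooth_derivable Dx.
have F (A B : V -> V) : \sum_k B x 0 k * 'D_(A x) (g k) x =
    \sum_k \sum_l B x 0 k * (A x 0 l * 'D_(delta_mx 0 l) (g k) x).
  apply: eq_bigr => k _; rewrite -mulr_sumr; congr (_ * _).
  exact: derive_coordE (smooth_differentiable (sg k) Dx).
rewrite (E X Y sY) (E Y X sX) opprD addrACA -!sumrB.
have -> : \sum_k (Y x 0 k * 'D_(X x) (g k) x - X x 0 k * 'D_(Y x) (g k) x) = 0.
  rewrite sumrB (F X Y) (F Y X); apply/eqP; rewrite subr_eq0; apply/eqP.
  rewrite exchange_big /=; apply: eq_bigr => k _; apply: eq_bigr => l _.
  by rewrite mulrCA gC.
rewrite add0r (derive_coordE _ (smooth_differentiable su Dx)).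
by apply: eq_bigr => k _; rewrite mxE mulrBl !(mulrC (g k x)) gE.
Qed.

End VectorFields.

(** * The strong maximum principle for sums of squares *)

Section Touching.
Variables (R : realType) (m : nat).
Local Notation V := 'rV[R]_m.

(** Positive exactly inside the ball that has [q] and [q + e] as antipodal
    points. *)
Definition touching (q e : V) : V -> R^o :=
  fun x => 2 * dot (x - q) e - 2 * dot (x - q) (x - q).

Section OnOpen.
Variable (D : set V).
Hypothesis oD : open D.

Lemma smooth_dot p (F G : V -> 'rV[R]_p) :
  smooth_on D F -> smooth_on D G -> smooth_on D (fun x => dot (F x) (G x) : R^o).
Proof.
move=> sF sG.
rewrite (_ : (fun x => _) = \sum_i (fun x => F x 0 i : R^o) * (fun x => G x 0 i : R^o)).
  by apply: smooth_sum => // i _; apply: smoothM => //; exact: smooth_entry.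
by apply/funext => x; rewrite fct_sumE.
Qed.

Lemma smooth_touching q e : smooth_on D (touching q e).
Proof.
have sq : smooth_on D (fun x => x - q).
  by apply: (smoothD oD); [exact: smooth_id|exact: smooth_cst].
rewrite (_ : touching q e = cst 2 * (fun x => dot (x - q) e : R^o) +
   cst (-2) * (fun x => dot (x - q) (x - q) : R^o)); last first.
  by apply/funext => x; rewrite !fctE /touching mulNr.
apply: (smoothD oD); apply: (smoothM oD); try exact: smooth_cst;
  apply: smooth_dot => //; exact: smooth_cst.
Qed.

End OnOpen.

Lemma continuous_touching q e : continuous (touching q e).
Proof.
by move=> x; apply: (smooth_continuous (smooth_touching openT q e)).
Qed.

Lemma derive_touching q e v : 'D_v (touching q e) q = 2 * dot v e.
Proof.
have sr := smooth_touching openT q e.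
have := @is_derive_line R _ (touching q e) q v 0.
rewrite scale0r addr0 => /(_ (smooth_derivable sr I))[_ <-].
rewrite (_ : (fun t : R => _) =
    (fun t : R => (2 * dot v e) * t - (2 * dot v v) * t ^+ 2 : R^o)); last first.
  apply/funext => t; rewrite /touching [q + _]addrC addrK !dotZl dotZr; ring.
rewrite derive_val /GRing.scale/=; ring.
Qed.

End Touching.

Section StrongMaximum.
Variables (R : realType) (m n : nat).
Local Notation V := 'rV[R]_m.
Variables (D : set V) (X : 'I_n -> V -> V).
Hypotheses (oD : open D) (sX : forall a, smooth_vect D (X a)).
Hypothesis spanX : forall x (e : V), D x -> e != 0 -> exists a, dot (X a x) e != 0.
Implicit Types (u t : V -> R^o).

(** The Laplacian of a hypersurface has this form when the [X a] are the
    tangential parts of an orthonormal basis of the ambient space. *)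
Definition sumsq u : V -> R^o := \sum_a vderiv (X a) (vderiv (X a) u).

Lemma sumsqE u x : sumsq u x = \sum_a vderiv (X a) (vderiv (X a) u) x.
Proof. by rewrite /sumsq fct_sumE. Qed.

Lemma smooth_sumsq u : smooth_on D u -> smooth_on D (sumsq u).
Proof. by move=> su; apply: smooth_sum => // a _; do 2!apply: smooth_vderiv => //. Qed.

Lemma sumsq_at_max u x : smooth_on D u -> D x ->
  (\forall y \near x, u y <= u x) -> sumsq u x <= 0.
Proof.
move=> su Dx ux; rewrite sumsqE; apply: sumr_le0 => a _.
exact: (vderiv2_at_max oD).
Qed.

Lemma sumsqDZ u w (c : R) x : smooth_on D u -> smooth_on D w -> D x ->
  sumsq (u + cst c * w) x = sumsq u x + c * sumsq w x.
Proof.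
move=> su sw Dx; have scw : smooth_on D (cst c * w : V -> R^o).
  by apply: smoothM => //; exact: smooth_cst.
rewrite !sumsqE mulr_sumr -big_split; apply: eq_bigr => a _.
by rewrite (vderiv2D oD)// [X in _ + X](vderiv2Z oD).
Qed.

Lemma sumsq_sqr u x : smooth_on D u -> D x ->
  sumsq (u * u) x = 2 * u x * sumsq u x + 2 * \sum_a vderiv (X a) u x ^+ 2.
Proof.
move=> su Dx; rewrite !sumsqE !mulr_sumr -big_split; apply: eq_bigr => a _.
by rewrite (vderiv2_sqr oD).
Qed.

(** Hopf's argument with the barrier [b = rho + K rho^2], where [rho] defines the
    touching ball. Near [q] it has the sign of [rho], and [sumsq b] is positive
    for large [K] because some [X a] is transverse to the ball. On a small sphere
    about [q], [t + eps b] stays below its value [c] at [q], so it has an interior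
    maximum, where [sumsq (t + eps b)] cannot be positive. *)
Lemma no_touching t c q e (r : R) : smooth_on D t ->
    (forall x, D x -> 0 <= sumsq t x) -> (forall x, D x -> t x <= c) ->
    D q -> t q = c -> e != 0 -> 0 < r ->
    (forall x, `|x - q| < r -> x != q -> 0 <= touching q e x -> t x < c) ->
  False.
Proof.
move=> st Lt tc Dq tq e0 r0 touch.
pose rho := touching q e.
have srho : smooth_on D rho by exact: smooth_touching.
have crho : continuous rho by exact: continuous_touching.
have rhoq : rho q = 0.
  by rewrite /rho /touching subrr /dot !big1 ?mulr0 ?subr0// => i _; rewrite mxE mul0r.
pose S0 := \sum_a vderiv (X a) rho q ^+ 2.
have S00 : 0 < S0.
  have [a Xa] := spanX Dq e0.
  rewrite /S0 (bigD1 a)//= ltr_pwDl//; last by apply: sumr_ge0 => ? _; rewrite sqr_ge0.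
  by rewrite exprn_even_gt0//= /vderiv derive_touching// mulf_neq0// pnatr_eq0.
(* large enough for the first order terms of [sumsq b q] to win *)
pose K := (`|sumsq rho q| + 1) / (2 * S0).
have K0 : 0 < K by rewrite divr_gt0 ?mulr_gt0// ltr_wpDl.
pose b : V -> R^o := rho + cst K * (rho * rho).
have srr : smooth_on D (rho * rho) by exact: smoothM.
have sb : smooth_on D b by apply: smoothD => //; apply: smoothM => //; exact: smooth_cst.
have bE x : b x = rho x * (1 + K * rho x) by rewrite /b !fctE; ring.
have Lbq : 0 < sumsq b q.
  rewrite sumsqDZ// sumsq_sqr// rhoq mulr0 mul0r add0r mulrA -/S0.
  rewrite (_ : K * 2 * S0 = `|sumsq rho q| + 1); last first.
    by rewrite -mulrA /K divfK// gt_eqF// mulr_gt0.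
  by have := ler_norm (- sumsq rho q); rewrite normrN; lra.
have near1 : \forall y \near q, [/\ D y, 0 < sumsq b y & 0 < 1 + K * rho y].
  have s1 : smooth_on D (cst 1 + cst K * rho : V -> R^o).
    apply: smoothD => //; first exact: smooth_cst.
    by apply: smoothM => //; exact: smooth_cst.
  have n1 := smooth_near_gt (smooth_sumsq sb) Dq Lbq.
  have n2 : \forall y \near q, 0 < (cst 1 + cst K * rho : V -> R^o) y.
    by apply: (smooth_near_gt s1 Dq); rewrite !fctE rhoq mulr0 addr0.
  by apply: filterS (filterI (near_open oD Dq) (filterI n1 n2)) => y [? []].
move/nbhs_ballP : near1 => [r1 r10 r1P].
pose d := Num.min r r1 / 2.
have d0 : 0 < d by rewrite divr_gt0// lt_min r0.
have dr : d < r.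
  by rewrite ltr_pdivrMr// (@le_lt_trans _ _ r) ?ge_min ?lexx// ltr_pMr// ltr1n.
have dr1 : d < r1.
  by rewrite ltr_pdivrMr// (@le_lt_trans _ _ r1) ?ge_min ?lexx ?orbT// ltr_pMr// ltr1n.
have dP x : `|x - q| <= d -> [/\ D x, 0 < sumsq b x & 0 < 1 + K * rho x].
  by move=> xd; apply: r1P; rewrite -ball_normE /ball_ /= distrC (le_lt_trans xd).
pose B := [set x : V | `|x - q| <= d].
have cnorm : continuous (fun x : V => `|x - q|).
  move=> x; apply: continuous_comp; last exact: norm_continuous.
  by apply: continuousB; [exact: cvg_id|exact: cst_continuous].
have bndB : bounded_set B.
  exists (d + `|q|); split; first by rewrite num_real.
  move=> M MM x /= xB; apply: le_trans (ltW MM).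
  by rewrite -lerBlDr (le_trans (lerB_dist _ _)).
have cB : compact B.
  apply: bounded_closed_compact => //.
  apply: (@closed_comp _ _ (fun x : V => `|x - q|) [set y | y <= d]).
    by move=> x _; exact: cnorm.
  exact: closed_le.
have contB (f : V -> R^o) (A : set V) : smooth_on D f -> A `<=` B ->
    {within A, continuous f}.
  move=> sf AB; apply: continuous_in_subspaceT => x /set_mem/AB/dP[Dx _ _].
  exact: smooth_continuous sf Dx.
pose A := [set x : V | `|x - q| = d /\ 0 <= rho x].
have AB : A `<=` B by move=> x [xd _]; rewrite /B /= xd.
have cA : compact A.
  apply: subclosed_compact cB AB; apply: closedI.
    apply: (@closed_comp _ _ (fun x : V => `|x - q|) [set y | y = d]).
      by move=> x _; exact: cnorm.
    exact: closed_eq.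
  apply: (@closed_comp _ _ rho [set y | 0 <= y]); last exact: closed_ge.
  by move=> x _; exact: crho.
have tA x : A x -> t x < c.
  move=> [xd rx]; apply: touch => //; first by rewrite xd.
  by rewrite -subr_eq0 -normr_gt0 xd.
(* the part of the sphere inside the touching ball is compact, and there [t < c] *)
have [eps eps0 epsP] : exists2 eps : R, 0 < eps & forall x, A x -> t x + eps * b x < c.
  have [A0|/set0P/negP] := pselect (A !=set0); last first.
    by rewrite negbK => /eqP A0; exists 1 => // x; rewrite A0.
  have [x1 /set_mem Ax1 max1] := EVT_max_rV A0 cA (contB _ _ st AB).
  have [x2 _ max2] := EVT_max_rV A0 cA (contB _ _ sb AB).
  have c0 : 0 < c - t x1 by rewrite subr_gt0 tA.
  have N0 : 0 < `|b x2| + 1 by rewrite ltr_wpDl.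
  exists ((c - t x1) / (`|b x2| + 1)); first by rewrite divr_gt0.
  move=> x /mem_set Ax; rewrite -ltrBrDl.
  apply: (@lt_le_trans _ _ (c - t x1)); last by rewrite lerB// max1.
  rewrite mulrAC ltr_pdivrMr// ltr_pM2l//.
  by rewrite (le_lt_trans (max2 _ Ax))// (le_lt_trans (ler_norm _))// ltrDl.
pose w : V -> R^o := t + cst eps * b.
have sw : smooth_on D w.
  by apply: smoothD => //; apply: smoothM => //; exact: smooth_cst.
have wE x : w x = t x + eps * b x by rewrite /w !fctE.
have Bq : B q by rewrite /B /= subrr normr0 ltW.
have [x /set_mem Bx maxw] :=
  EVT_max_rV (ex_intro _ q Bq) cB (contB _ _ sw (@subset_refl _ B)).
have wq : c <= w x.
  by rewrite (le_trans _ (maxw _ (mem_set Bq)))// wE tq bE rhoq mul0r mulr0 addr0.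
have [Dx Lbx rx] := dP _ Bx.
have xd : `|x - q| < d.
  rewrite lt_neqAle; apply/andP; split => //; apply/eqP => xd.
  move: wq; rewrite leNgt => /negP; apply; rewrite wE.
  have [r0x|r0x] := leP 0 (rho x); first exact: epsP.
  by rewrite -[ltRHS]addr0 ler_ltD ?tc// pmulr_rlt0// bE pmulr_llt0.
have : sumsq w x <= 0.
  apply: sumsq_at_max => //; apply/nbhs_ballP; exists (d - `|x - q|) => /=.
    by rewrite subr_gt0.
  move=> y; rewrite -ball_normE /ball_ /= ltrBrDr => yx; apply: maxw.
  apply: mem_set => /=; apply: le_trans (ltW yx).
  by rewrite distrC (le_trans (ler_distD x _ _))// [`|q - x|]distrC addrC.
rewrite sumsqDZ// leNgt => /negP; apply.
by rewrite ltr_wpDl ?Lt// mulr_gt0.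
Qed.

(** If the maximum set were not a neighbourhood of [x0], a point of it nearest
    to a point outside would be touched by a ball. *)
Lemma strong_maximum t c x0 : smooth_on D t ->
    (forall x, D x -> 0 <= sumsq t x) -> (forall x, D x -> t x <= c) ->
    D x0 -> t x0 = c -> \forall x \near x0, t x = c.
Proof.
move=> st Lt tc Dx0 tx0.
have [s s0 sD] : exists2 s : R, 0 < s & forall x, `|x - x0| <= s -> D x.
  have /nbhs_ballP[e e0 eP] := near_open oD Dx0.
  exists (e / 2); first by rewrite divr_gt0.
  move=> x xs; apply: eP; rewrite -ball_normE /ball_ /= distrC.
  by rewrite (le_lt_trans xs)// ltr_pdivrMr// ltr_pMr// ltr1n.
pose S := [set x : V | `|x - x0| <= s /\ t x = c].
have closedS : closed S.
  move=> x clS; have xs : `|x - x0| <= s.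
    have : closed [set x : V | `|x - x0| <= s].
      apply: (@closed_comp _ _ (fun x : V => `|x - x0|) [set y | y <= s]).
        move=> z _; apply: continuous_comp; last exact: norm_continuous.
        by apply: continuousB; [exact: cvg_id|exact: cst_continuous].
      exact: closed_le.
    by apply; apply: closure_subset clS => z [].
  have Dx := sD _ xs; split=> //.
  apply/eqP; rewrite eq_le tc//= leNgt; apply/negP => txc.
  have sNt : smooth_on D (- t) by exact: smoothN.
  have near1 : \forall y \near x, - c < (- t) y.
    by apply: (smooth_near_gt sNt Dx); rewrite fctE ltrN2.
  have [z [[_ tz]]] := clS _ near1.
  by rewrite /= fctE tz ltxx.
have bndS : bounded_set S.
  exists (s + `|x0|); split; first by rewrite num_real.
  move=> M MM x /= [xS _]; apply: le_trans (ltW MM).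
  by rewrite -lerBlDr (le_trans (lerB_dist _ _)).
have cS : compact S by exact: bounded_closed_compact.
have S0 : S !=set0 by exists x0; split=> //; rewrite subrr normr0 ltW.
have s2 : 0 < s / 2 by rewrite divr_gt0.
have smQ (y : V) : smooth_on setT (fun x => dot (x - y) (x - y) : R^o).
  by apply: (smooth_dot openT); apply: (smoothD openT);
    try exact: smooth_cst; exact: (smooth_id openT).
have near1 : \forall y \near x0, dot (y - x0) (y - x0) < (s / 2) ^+ 2.
  have sN : smooth_on setT (- (fun x => dot (x - x0) (x - x0) : R^o)).
    exact: (smoothN openT).
  have lt0 : - (s / 2) ^+ 2 < (- (fun x => dot (x - x0) (x - x0) : R^o)) x0.
    rewrite [ltRHS](_ : _ = - dot (x0 - x0) (x0 - x0))// ltrN2 subrr.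
    by rewrite {1}/dot big1 ?exprn_gt0// => i _; rewrite mxE mul0r.
  by apply: filterS (smooth_near_gt sN I lt0) => y; rewrite ltrN2.
apply: filterS near1 => y yx0; apply: contrapT => ty.
have yn : `|y - x0| < s / 2 by exact: normr_lt_dot.
have half_le : s / 2 <= s by rewrite ler_pdivrMr// ler_pMr// ler1n.
have [q /set_mem[qs tq] qmin] := EVT_min_rV S0 cS
  (continuous_subspaceT (fun x => smooth_continuous (smQ y) I)).
have Sx0 : S x0 by split=> //; rewrite subrr normr0 ltW.
have qy : `|q - y| < s / 2.
  apply: normr_lt_dot => //; apply: le_lt_trans (qmin _ (mem_set Sx0)) _.
  by rewrite -opprB dotNl dotNr opprK.
have qx : `|q - x0| < s.
  by rewrite (le_lt_trans (ler_distD y _ _))// [ltRHS]splitr ltrD.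
have Dq := sD _ (ltW qx).
apply: (@no_touching t c q (y - q) (s - `|q - x0|)) => //.
- by rewrite subr_eq0; apply/eqP => yq; apply: ty; rewrite yq.
- by rewrite subr_gt0.
move=> x; rewrite ltrBrDr => xr xq touch.
have xs : `|x - x0| <= s by rewrite (le_trans (ler_distD q _ _))// ltW.
(* a point [x] of [S] inside the ball of diameter [q y] would be nearer to [y] *)
rewrite lt_neqAle tc ?andbT; last exact: sD.
apply/eqP => tx; have := qmin x (mem_set (conj xs tx)).
have -> : x - y = (x - q) - (y - q) by rewrite opprB addrA subrK.
have -> : q - y = - (y - q) by rewrite opprB.
have xq0 : 0 < dot (x - q) (x - q).
  by rewrite lt_def dot_ge0 dot_eq0 subr_eq0 xq.
move: touch xq0; rewrite /touching; move: (x - q) (y - q) => z e.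
by rewrite dotDl !dotDr !dotNl !dotNr (dotC e z); lra.
Qed.

End StrongMaximum.

(** * The Simons identity in a ring with derivations *)

Section Derivations.
Variables (K : comPzRingType) (n : nat) (d : 'I_n -> K -> K).
Hypothesis dD : forall a u v, d a (u + v) = d a u + d a v.

Lemma deriv0 a : d a 0 = 0.
Proof. by apply: (addrI (d a 0)); rewrite -dD !addr0. Qed.

Lemma derivN a u : d a (- u) = - d a u.
Proof. by apply: (addrI (d a u)); rewrite -dD !subrr deriv0. Qed.

Lemma derivB a u v : d a (u - v) = d a u - d a v.
Proof. by rewrite dD derivN. Qed.

Lemma deriv1 : (forall a u v, d a (u * v) = u * d a v + v * d a u) ->
  forall a, d a 1 = 0.
Proof.
by move=> dM a; apply: (addrI (d a 1)); rewrite -{3}(mulr1 1) dM !mul1r addr0.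
Qed.

Lemma deriv_sum a (I : finType) (F : I -> K) : d a (\sum_i F i) = \sum_i d a (F i).
Proof. by apply: (big_morph (d a)); [exact: dD|exact: deriv0]. Qed.

End Derivations.

Section TangentialFrame.
Variables (K : comPzRingType) (n : nat) (d : 'I_n -> K -> K).
Variables (x nu : 'I_n -> K).
Hypothesis dD : forall a u v, d a (u + v) = d a u + d a v.
Hypothesis dM : forall a u v, d a (u * v) = u * d a v + v * d a u.

(** The model: [d a] differentiates along the tangential part of the [a]-th vector
    of the standard basis of the ambient space, [x] and [nu] are the components of
    the position and of the unit normal, and [h] is the second fundamental form,
    extended by zero to the normal direction. *)
Let h a b := - d a (nu b).
Let br a b u := d a (d b u) - d b (d a u).

Hypothesis dx : forall a b, d a (x b) = (a == b)%:R - nu a * nu b.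
Hypothesis nu1 : \sum_a nu a * nu a = 1.
Hypothesis nudnu : forall a, \sum_c nu c * d a (nu c) = 0.
Hypothesis brx : forall a b u, br a b u = \sum_c br a b (x c) * d c u.
Hypothesis brnu : forall a b, \sum_c nu c * br a b (x c) = 0.
Hypothesis nud : forall u, \sum_a nu a * d a u = 0.

Lemma bracket_coord a b c : br a b (x c) =
  nu b * h a c + nu c * h a b - nu a * h b c - nu c * h b a.
Proof.
have dd e f g : d e (d f (x g)) = nu f * h e g + nu g * h e f.
  rewrite dx (derivB dD) dM (_ : d e (f == g)%:R = 0); first by rewrite /h; ring.
  by case: (f == g); rewrite ?mulr1n ?mulr0n ?(deriv1 dM) ?(deriv0 dD).
by rewrite /br !dd; ring.
Qed.

(** Brackets of tangential fields are tangential, which forces the symmetry. *)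
Lemma form_sym a b : h a b = h b a.
Proof.
apply/eqP; rewrite -subr_eq0; apply/eqP; rewrite -(brnu a b).
transitivity (nu a * (\sum_c nu c * d b (nu c)) - nu b * (\sum_c nu c * d a (nu c))
    + (\sum_c nu c * nu c) * (h a b - h b a)).
  by rewrite !nudnu nu1; ring.
rewrite !mulr_sumr mulr_suml -sumrB -big_split /=; apply: eq_bigr => c _.
by rewrite bracket_coord /h; ring.
Qed.

Lemma bracket_form a b u :
  br a b u = \sum_c (nu b * h a c - nu a * h b c) * d c u.
Proof.
rewrite brx; apply: eq_bigr => c _.
by rewrite bracket_coord (form_sym b a); ring.
Qed.

End TangentialFrame.

Section SimonsIdentity.
Variables (K : comPzRingType) (n : nat) (d : 'I_n -> K -> K) (nu : 'I_n -> K).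
Hypothesis dD : forall a u v, d a (u + v) = d a u + d a v.
Hypothesis dM : forall a u v, d a (u * v) = u * d a v + v * d a u.
Let h a b := - d a (nu b).
Hypothesis hC : forall a b, h a b = h b a.
Hypothesis nu1 : \sum_a nu a * nu a = 1.
Hypothesis nud : forall u, \sum_a nu a * d a u = 0.
Hypothesis comm : forall a b u,
  d a (d b u) - d b (d a u) = \sum_c (nu b * h a c - nu a * h b c) * d c u.
Hypothesis dH : forall b, d b (\sum_a h a a) = 0.
Let h2 a b := \sum_c h a c * h c b.

Lemma normal_form a : \sum_b nu b * h a b = 0.
Proof.
under eq_bigr do rewrite hC mulrN.
by rewrite sumrN nud oppr0.
Qed.

Lemma form2_sym a b : h2 a b = h2 b a.
Proof. by apply: eq_bigr => c _; rewrite mulrC (hC a) (hC c). Qed.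

Lemma normal_form2 a : \sum_b nu b * h2 a b = 0.
Proof.
under eq_bigr do rewrite mulr_sumr.
rewrite exchange_big big1//= => c _.
under eq_bigr do rewrite mulrCA.
by rewrite -mulr_sumr normal_form mulr0.
Qed.

Lemma deriv_normal a b : d a (nu b) = - h a b.
Proof. by rewrite opprK. Qed.

(** The Codazzi equation. The terms in [h2] appear because the directions [d a]
    are projections of constant vectors and do not commute. *)
Lemma codazzi a b c :
  d c (h a b) = d a (h c b) + nu a * h2 c b - nu c * h2 a b.
Proof.
rewrite /h !(derivN dD).
have -> : d c (d a (nu b)) = d a (d c (nu b)) + (nu c * h2 a b - nu a * h2 c b).
  rewrite -[LHS](subrK (d a (d c (nu b)))) addrC comm; congr (_ + _).
  rewrite /h2 !mulr_sumr -sumrB; apply: eq_bigr => e _.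
  by rewrite deriv_normal; ring.
ring.
Qed.

(** Differentiate [normal_form]. *)
Lemma normal_deriv_form c b : \sum_a nu a * d c (h a b) = h2 c b.
Proof.
have : d c (\sum_a nu a * h b a) = 0 by rewrite normal_form (deriv0 dD).
rewrite (deriv_sum dD); under eq_bigr do rewrite dM.
rewrite big_split /= => /eqP; rewrite addr_eq0 => /eqP.
under eq_bigr do rewrite hC.
move=> ->; rewrite -sumrN; apply: eq_bigr => a _.
by rewrite deriv_normal (hC b); ring.
Qed.

Let H := \sum_a h a a.
Let t2 := \sum_a \sum_b h a b * h a b.
Let t3 := \sum_a \sum_b h2 a b * h a b.
Let t4 := \sum_a \sum_b h2 a b * h2 a b.
Let lap u := \sum_c d c (d c u).

Lemma tr_form2 : \sum_a h2 a a = t2.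
Proof. by apply: eq_bigr => a _; apply: eq_bigr => b _; rewrite (hC b). Qed.

(** The trace of the Codazzi equation; this is where [tr h] has to be constant. *)
Lemma div_form b : \sum_c d c (h c b) = nu b * t2.
Proof.
transitivity (\sum_c (d b (h c c) + nu b * h2 c c - nu c * h2 b c)).
  by apply: eq_bigr => c _; rewrite hC codazzi.
rewrite sumrB big_split /= -(deriv_sum dD) dH add0r -mulr_sumr tr_form2.
by rewrite normal_form2 subr0.
Qed.

(** Differentiate the Codazzi equation and commute derivatives. The terms with a
    factor [nu] vanish on contraction with [h], so their coefficients are left
    unspecified. *)
Lemma laplacian_form : exists al be : 'I_n -> K, forall a b,
  lap (h a b) = nu b * al a + nu a * be b - t2 * h a b
     - (\sum_c h a c * h2 c b) *+ 2 + H * h2 a b.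
Proof.
exists (fun a => d a t2).
exists (fun b => \sum_c \sum_e h c e * d e (h c b) + \sum_c d c (h2 c b)) => a b.
have E c : d c (d c (h a b)) = d a (d c (h c b)) +
    \sum_e (nu a * h c e - nu c * h a e) * d e (h c b) +
    (nu a * d c (h2 c b) - h2 c b * h c a) - (nu c * d c (h2 a b) - h2 a b * h c c).
  rewrite {1}codazzi (derivB dD) dD !dM !deriv_normal.
  rewrite -comm; ring.
rewrite /lap (eq_bigr _ (fun c _ => E c)) sumrB !big_split /= !sumrN.
rewrite -(deriv_sum dD) div_form dM deriv_normal nud.
have -> : \sum_c \sum_e (nu a * h c e - nu c * h a e) * d e (h c b) =
    nu a * (\sum_c \sum_e h c e * d e (h c b)) - \sum_c h a c * h2 c b.
  transitivity (\sum_c \sum_e nu a * (h c e * d e (h c b)) -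
      \sum_e \sum_c h a e * (nu c * d e (h c b))).
    rewrite [X in _ - X]exchange_big /= -sumrB; apply: eq_bigr => c _.
    by rewrite -sumrB; apply: eq_bigr => e _; ring.
  rewrite mulr_sumr; congr (_ - _).
    by apply: eq_bigr => c _; rewrite mulr_sumr.
  by apply: eq_bigr => e _; rewrite -mulr_sumr normal_deriv_form.
have -> : \sum_c h2 c b * h c a = \sum_c h a c * h2 c b.
  by apply: eq_bigr => c _; rewrite (hC a) mulrC.
have -> : \sum_c h2 a b * h c c = H * h2 a b.
  by rewrite -mulr_sumr mulrC.
rewrite -mulr_sumr.
by ring.
Qed.

Lemma form_laplacian_form :
  \sum_a \sum_b h a b * lap (h a b) = H * t3 - t2 * t2 - t4 *+ 2.
Proof.
have [al [be E]] := laplacian_form.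
transitivity (\sum_a \sum_b (al a * (nu b * h a b)) +
    \sum_b \sum_a (be b * (nu a * h a b)) - \sum_a \sum_b t2 * (h a b * h a b) -
    (\sum_a \sum_b \sum_c (h a b * h a c) * h2 c b) *+ 2 +
    \sum_a \sum_b (H * (h2 a b * h a b))).
  rewrite [X in _ + X - _ - _ + _]exchange_big /=.
  rewrite -big_split /= -sumrB -sumrMnl -sumrB -big_split /=.
  apply: eq_bigr => a _.
  rewrite -big_split /= -sumrB -sumrMnl -sumrB -big_split /=.
  apply: eq_bigr => b _; rewrite E.
  under [X in _ = _ - X *+ 2 + _]eq_bigr do rewrite -mulrA.
  by rewrite -mulr_sumr; ring.
have -> : \sum_a \sum_b al a * (nu b * h a b) = 0.
  by apply: big1 => a _; rewrite -mulr_sumr normal_form mulr0.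
have -> : \sum_b \sum_a be b * (nu a * h a b) = 0.
  apply: big1 => b _; rewrite -mulr_sumr.
  by under eq_bigr do rewrite hC; rewrite normal_form mulr0.
have -> : \sum_a \sum_b \sum_c (h a b * h a c) * h2 c b = t4.
  rewrite exchange_big /t4; apply: eq_bigr => b _; rewrite exchange_big.
  apply: eq_bigr => c _; rewrite -mulr_suml (form2_sym c b); congr (_ * _).
  by apply: eq_bigr => a _; rewrite (hC b).
have -> : \sum_a \sum_b t2 * (h a b * h a b) = t2 * t2.
  by under eq_bigr do rewrite -mulr_sumr; rewrite -mulr_sumr.
have -> : \sum_a \sum_b H * (h2 a b * h a b) = H * t3.
  by under eq_bigr do rewrite -mulr_sumr; rewrite -mulr_sumr.
by ring.
Qed.

(** [W] is the tangential part of the derivative of [h], i.e. the covariant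
    derivative of the shape operator. *)
Let W c a b := d c (h a b) - nu a * h2 c b - nu b * h2 c a.

(** By [normal_deriv_form] the normal components of the derivative of [h] are
    those of [h2]. *)
Lemma sum_deriv_form_sqr : \sum_c \sum_a \sum_b d c (h a b) * d c (h a b) =
  \sum_c \sum_a \sum_b W c a b * W c a b + t4 *+ 2.
Proof.
have E c : \sum_a \sum_b W c a b * W c a b =
   \sum_a \sum_b d c (h a b) * d c (h a b)
   - (\sum_b h2 c b * h2 c b) *+ 2.
  transitivity (\sum_a \sum_b d c (h a b) * d c (h a b)
    - (\sum_b \sum_a h2 c b * (nu a * d c (h a b))) *+ 2
    - (\sum_a \sum_b h2 c a * (nu b * d c (h b a))) *+ 2
    + \sum_a \sum_b (nu a * nu a) * (h2 c b * h2 c b)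
    + \sum_b \sum_a (nu b * nu b) * (h2 c a * h2 c a)
    + (\sum_a \sum_b (nu a * h2 c a) * (nu b * h2 c b)) *+ 2).
    rewrite [X in _ - X *+ 2 - _ + _ + _ + _]exchange_big /=.
    rewrite [X in _ + X + _ *+ 2]exchange_big /=.
    rewrite -!sumrMnl -!sumrB -!big_split /=.
    apply: eq_bigr => a _; rewrite -!sumrMnl -!sumrB -!big_split /=.
    by apply: eq_bigr => b _; rewrite /W (hC b a); ring.
  have -> : \sum_b \sum_a h2 c b * (nu a * d c (h a b)) = \sum_b h2 c b * h2 c b.
    by apply: eq_bigr => b _; rewrite -mulr_sumr normal_deriv_form.
  have N : \sum_a \sum_b (nu a * nu a) * (h2 c b * h2 c b) = \sum_b h2 c b * h2 c b.
    by under eq_bigr do rewrite -mulr_sumr; rewrite -mulr_suml nu1 mul1r.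
  have -> : \sum_a \sum_b (nu a * h2 c a) * (nu b * h2 c b) = 0.
    by apply: big1 => a _; rewrite -mulr_sumr normal_form2 mulr0.
  by rewrite N; ring.
rewrite (eq_bigr _ (fun c _ => E c)) sumrB sumrMnl -/t4.
by ring.
Qed.

(** The Simons identity, for a hypersurface of constant mean curvature. *)
Theorem simons : lap t2 =
  (\sum_c \sum_a \sum_b W c a b * W c a b + H * t3 - t2 * t2) *+ 2.
Proof.
have E : lap t2 = (\sum_c \sum_a \sum_b d c (h a b) * d c (h a b) +
    \sum_a \sum_b h a b * lap (h a b)) *+ 2.
  transitivity (\sum_c \sum_a \sum_b
      (d c (h a b) * d c (h a b) + h a b * d c (d c (h a b))) *+ 2).
    apply: eq_bigr => c _; rewrite /t2 !(deriv_sum dD); apply: eq_bigr => a _.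
    rewrite !(deriv_sum dD); apply: eq_bigr => b _.
    by rewrite dM !dD !dM; ring.
  have -> : \sum_a \sum_b h a b * lap (h a b) =
      \sum_c \sum_a \sum_b h a b * d c (d c (h a b)).
    rewrite [RHS]exchange_big /=; apply: eq_bigr => a _.
    by rewrite [RHS]exchange_big /=; apply: eq_bigr => b _; rewrite mulr_sumr.
  rewrite -big_split /= -sumrMnl; apply: eq_bigr => c _.
  rewrite -big_split /= -sumrMnl; apply: eq_bigr => a _.
  by rewrite -big_split /= -sumrMnl; apply: eq_bigr => b _.
by rewrite E form_laplacian_form sum_deriv_form_sqr; ring.
Qed.

End SimonsIdentity.

(** * Pinched symmetric forms *)

(** Orthogonal projection along [nu], when [nu] is a unit vector. *)
Definition tangent_proj (R : realType) (n : nat) (nu : 'rV[R]_n) : 'M[R]_n :=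
  1%:M - nu^T *m nu.

Section TraceIdentities.
Variables (R : fieldType) (n : nat) (h E Q : 'M[R]_n).
Hypotheses (proj_idem : Q *m Q = Q) (form_proj : h *m Q = h) (proj_form : Q *m h = h).

Lemma tr_sqr_comb (a b : R) : E *m E = E -> E *m Q = E -> Q *m E = E ->
  let B := h - a *: E - b *: Q in
  \tr (B *m B) = \tr (h *m h) + a ^+ 2 * \tr E + b ^+ 2 * \tr Q
    - 2 * a * \tr (h *m E) - 2 * b * \tr h + 2 * a * b * \tr E.
Proof.
move=> EE EQ QE /=.
rewrite !mulmxBl !mulmxBr -!scalemxAl -!scalemxAr EE EQ QE proj_idem form_proj proj_form.
rewrite !mxtraceD !raddfN /= !mxtraceD !raddfN /= !mxtraceZ.
by rewrite (mxtrace_mulC E h); ring.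
Qed.

Lemma tr_mul_sqr_comb (b : R) : let W := h - b *: Q in
  \tr (h *m (W *m W)) = \tr (h *m h *m h) - 2 * b * \tr (h *m h) + b ^+ 2 * \tr h.
Proof.
rewrite /= !mulmxBl !mulmxBr -!scalemxAl -!scalemxAr proj_idem form_proj proj_form.
rewrite ?mulmxBr -?scalemxAr ?form_proj.
rewrite !mxtraceD !raddfN /= !mxtraceD !raddfN /= !mxtraceZ mulmxA.
by ring.
Qed.

Lemma tr_comb (a b : R) : h^T = h -> E^T = E -> Q^T = Q ->
  (h - a *: E - b *: Q)^T = h - a *: E - b *: Q.
Proof. by move=> hT ET proj_sym; rewrite !linearB /= !linearZ /= hT ET proj_sym. Qed.

End TraceIdentities.

Section PinchedForm.
Variables (R : realType) (m : nat).
Variables (h : 'M[R]_m.+1) (nu : 'rV[R]_m.+1).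
Hypotheses (hT : h^T = h) (hnu : nu *m h = 0) (nu1 : dot nu nu = 1).
Local Notation H := (\tr h).
Local Notation Q := (tangent_proj nu).

Lemma tr_mul_rv (u v : 'rV[R]_m.+1) : \tr (u^T *m v) = dot u v.
Proof. by rewrite mxtrace_mulC trace_mx11 -dotE dotC. Qed.

Lemma sqr_tr_ge0 p (B : 'M[R]_p) : 0 <= \tr (B *m B^T).
Proof.
rewrite /mxtrace sumr_ge0// => i _; rewrite mxE sumr_ge0// => j _.
by rewrite mxE -expr2 sqr_ge0.
Qed.

Lemma sqr_tr_eq0 p (B : 'M[R]_p) : \tr (B *m B^T) <= 0 -> B = 0.
Proof.
move=> B0; have E i : (B *m B^T) i i = dot (row i B) (row i B).
  by rewrite mxE; apply: eq_bigr => j _; rewrite !mxE.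
have /eqP : \tr (B *m B^T) = 0 by apply/eqP; rewrite eq_le B0 sqr_tr_ge0.
rewrite /mxtrace psumr_eq0 => [/allP Bz|i _]; last by rewrite E dot_ge0.
apply/row_matrixP => i; have := Bz i (mem_index_enum _).
by rewrite E dot_eq0 row0 => /eqP.
Qed.

Lemma normal_proj : nu *m Q = 0.
Proof.
by rewrite mulmxBr mulmx1 mulmxA [nu *m _]mx11_scalar -dotE nu1 mul1mx subrr.
Qed.

Lemma proj_idem : Q *m Q = Q.
Proof. by rewrite {1}/tangent_proj mulmxBl mul1mx -mulmxA normal_proj mulmx0 subr0. Qed.

Lemma proj_sym : Q^T = Q.
Proof. by rewrite /tangent_proj linearB /= trmx1 trmx_mul trmxK. Qed.

Lemma form_proj : h *m Q = h.
Proof.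
rewrite mulmxBr mulmx1 mulmxA.
have -> : h *m nu^T = 0 by rewrite -{1}hT -trmx_mul hnu trmx0.
by rewrite mul0mx subr0.
Qed.

Lemma proj_form : Q *m h = h.
Proof. by apply: trmx_inj; rewrite trmx_mul hT proj_sym form_proj. Qed.

Lemma tr_proj : \tr Q = m%:R.
Proof.
by rewrite /tangent_proj raddfB /= mxtrace1 tr_mul_rv nu1 -natr1 addrK.
Qed.

(** [h] is compared with the diagonal form that has the value of [h] on [v] and
    is constant on the orthogonal complement of [v] and [nu]. *)
Lemma pinched_unit v : (1 < m)%N -> dot v v = 1 -> dot v nu = 0 ->
  \tr (h *m h) <= H ^+ 2 / (m%:R - 1) -> 0 <= H * (v *m h *m v^T) 0 0.
Proof.
move=> m1 v1 vnu pinch; set a := (_ *m v^T) 0 0.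
have m0 : 0 < m%:R - 1 :> R by rewrite subr_gt0 ltr1n.
pose b := (H - a) / (m%:R - 1).
pose E := v^T *m v.
have EE : E *m E = E.
  by rewrite /E mulmxA -(mulmxA _ v) [v *m v^T]mx11_scalar -dotE v1 mulmx1.
have EQ : E *m Q = E.
  rewrite /tangent_proj mulmxBr mulmx1 /E !mulmxA -(mulmxA _ v) [v *m nu^T]mx11_scalar.
  by rewrite -dotE vnu mul_mx_scalar scale0r mul0mx subr0.
have ET : E^T = E by rewrite trmx_mul trmxK.
have QE : Q *m E = E by apply: trmx_inj; rewrite trmx_mul ET proj_sym.
have trE : \tr E = 1 by rewrite tr_mul_rv.
have trhE : \tr (h *m E) = a.
  by rewrite mxtrace_mulC -mulmxA mxtrace_mulC trace_mx11.
clearbody E; have := sqr_tr_ge0 (h - (a - b) *: E - b *: Q).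
rewrite tr_comb ?proj_sym// tr_sqr_comb ?proj_idem ?form_proj ?proj_form//.
rewrite trE trhE tr_proj => B0.
have : a ^+ 2 + (H - a) ^+ 2 / (m%:R - 1) <= \tr (h *m h).
  rewrite -subr_ge0; apply: le_trans B0 _.
  have -> : (H - a) ^+ 2 / (m%:R - 1) = b ^+ 2 * (m%:R - 1).
    by rewrite /b expr_div_n expr2; field; rewrite gt_eqF.
  have : b * (m%:R - 1) = H - a by rewrite /b divfK// gt_eqF.
  by move: (m%:R : R) => M Eb; rewrite le_eqVlt; apply/orP; left; apply/eqP; nra.
move=> /le_trans/(_ pinch); rewrite -(ler_pM2r m0) mulrDl !divfK ?gt_eqF//.
have : 0 <= (m%:R : R) * a ^+ 2 by rewrite mulr_ge0// sqr_ge0.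
by move: (m%:R : R) => M; nra.
Qed.

(** Pinching makes all principal curvatures have the sign of the trace. *)
Lemma pinched_semidefinite (v : 'rV[R]_m.+1) : (1 < m)%N ->
  \tr (h *m h) <= H ^+ 2 / (m%:R - 1) -> 0 <= H * (v *m h *m v^T) 0 0.
Proof.
move=> m1 pinch; pose w := v - dot v nu *: nu.
have -> : v *m h *m v^T = w *m h *m w^T.
  have wh : w *m h = v *m h by rewrite mulmxBl -scalemxAl hnu scaler0 subr0.
  have hw : h *m w^T = h *m v^T by apply: trmx_inj; rewrite !trmx_mul !trmxK hT.
  by rewrite wh -!mulmxA hw.
have wnu : dot w nu = 0 by rewrite dotDl dotNl dotZl nu1 mulr1 subrr.
have [->|w0] := eqVneq w 0; first by rewrite !mul0mx mxE mulr0.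
have ww : 0 < dot w w by rewrite lt_def dot_ge0 dot_eq0 w0.
pose c := Num.sqrt (dot w w).
have c0 : 0 < c by rewrite sqrtr_gt0.
have u1 : dot (c^-1 *: w) (c^-1 *: w) = 1.
  have -> : dot (c^-1 *: w) (c^-1 *: w) = c^-1 * (c^-1 * dot w w).
    by rewrite dotZl dotZr.
  have -> : dot w w = c * c by rewrite -expr2 sqr_sqrtr ?dot_ge0.
  by rewrite mulKf ?mulVf ?gt_eqF.
have unu : dot (c^-1 *: w) nu = 0 by rewrite dotZl wnu mulr0.
have := pinched_unit m1 u1 unu pinch.
rewrite linearZ /= -!scalemxAl -scalemxAr !mxE mulrCA pmulr_rge0 ?invr_gt0//.
by rewrite mulrCA pmulr_rge0 ?invr_gt0.
Qed.

Let tau := \tr (h *m h) / H.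
Let W := h - tau *: Q.

Lemma deviator_sym : W^T = W.
Proof.
have := @tr_comb _ _ h 0 Q 0 tau hT (trmx0 _ _ _) proj_sym.
by rewrite scale0r subr0.
Qed.

Lemma tr_form_deviator : H != 0 ->
  H * \tr (h *m (W *m W)) = H * \tr (h *m h *m h) - \tr (h *m h) ^+ 2.
Proof.
by move=> H0; rewrite /W tr_mul_sqr_comb ?proj_idem ?form_proj ?proj_form// /tau; field.
Qed.

(** By the symmetry of [W]; the trace becomes a sum of values of the form [h]. *)
Lemma tr_form_deviator_rows : \tr (h *m (W *m W)) =
  \sum_i (row i W *m h *m (row i W)^T) 0 0.
Proof.
rewrite mulmxA mxtrace_mulC mulmxA /mxtrace; apply: eq_bigr => i _.
rewrite -row_mul mxE [RHS]mxE; apply: eq_bigr => k _.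
have E1 : (row i W)^T k 0 = W i k by rewrite [LHS]mxE [LHS]mxE.
have E2 : W k i = W i k by rewrite -{1}deviator_sym [LHS]mxE.
by rewrite E1 E2 [X in _ = X * _]mxE.
Qed.

(** The difference of the two sides is [H * \tr (h * W ^ 2)], a sum of values of
    the semidefinite form [H * h]. *)
Lemma pinched_cubic : (1 < m)%N -> H != 0 ->
  \tr (h *m h) <= H ^+ 2 / (m%:R - 1) ->
  \tr (h *m h) ^+ 2 <= H * \tr (h *m h *m h).
Proof.
move=> m1 H0 pinch; rewrite -subr_ge0 -tr_form_deviator// tr_form_deviator_rows mulr_sumr.
by apply: sumr_ge0 => i _; exact: pinched_semidefinite.
Qed.

(** Equality in [pinched_cubic] makes a sum of values of the definite form [h]
    vanish, hence [W = 0]. *)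
Lemma definite_cubic_eq (s : R) : (0 < m)%N -> H != 0 ->
  (forall v, dot v nu = 0 -> s * (v *m h *m v^T) 0 0 <= - dot v v) ->
  H * \tr (h *m h *m h) = \tr (h *m h) ^+ 2 -> \tr (h *m h) = H ^+ 2 / m%:R.
Proof.
move=> m0 H0 neg eqc.
have Wnu i : dot (row i W) nu = 0.
  rewrite dotE -row_mul -deviator_sym -trmx_mul mulmxBr hnu -scalemxAr normal_proj.
  rewrite scaler0 subr0.
  by rewrite trmx0 row0 mxE.
have /eqP : H * \tr (h *m (W *m W)) = 0 by rewrite tr_form_deviator// eqc subrr.
rewrite mulf_eq0 (negPf H0) /= => /eqP tr0.
have W0 : W = 0.
  apply: sqr_tr_eq0.
  have -> : \tr (W *m W^T) = \sum_i dot (row i W) (row i W).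
    by apply: eq_bigr => i _; rewrite mxE; apply: eq_bigr => j _; rewrite !mxE.
  have : s * \tr (h *m (W *m W)) <= - \sum_i dot (row i W) (row i W).
    by rewrite tr_form_deviator_rows mulr_sumr -sumrN; apply: ler_sum => i _; exact: neg.
  by rewrite tr0 mulr0 oppr_ge0.
have hE : h = tau *: Q by apply/eqP; rewrite -subr_eq0 -/W W0.
have HE : H = tau * m%:R by rewrite {1}hE linearZ /= tr_proj.
have {1}-> : \tr (h *m h) = tau * H by rewrite /tau divfK.
by rewrite [in RHS]expr2 {2}HE; field; rewrite pnatr_eq0 -lt0n.
Qed.

(** The Frobenius norm of [h - (H / m) *: Q] vanishes. *)
Lemma umbilic_of_tr : (0 < m)%N -> \tr (h *m h) = H ^+ 2 / m%:R ->
  h = (H / m%:R) *: Q.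
Proof.
move=> m0 e; have m0' : m%:R != 0 :> R by rewrite pnatr_eq0 -lt0n.
apply/eqP; rewrite -subr_eq0; apply/eqP/sqr_tr_eq0.
set b := H / m%:R; have E0 (c : R) : h - c *: Q = h - 0 *: 0 - c *: Q.
  by rewrite scale0r subr0.
rewrite E0 tr_comb ?proj_sym ?trmx0//.
rewrite tr_sqr_comb ?proj_idem ?form_proj ?proj_form ?mulmx0 ?mul0mx//.
rewrite mxtrace0 tr_proj e /b le_eqVlt; apply/orP; left.
by apply/eqP; field.
Qed.

End PinchedForm.

(** * Calculus in charts *)

Section ChartCalculus.
Variables (R : realType) (m : nat) (M : orientedManifold R m).
Local Notation idx := (atlas_index M).

Lemma open_cod (i : idx) : open (cod (atlas i)).
Proof. exact: cod_open. Qed.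
Arguments open_cod i : clear implicits.

Lemma cod_coord (i : idx) p : dom (atlas i) p -> cod (atlas i) (coord (atlas i) p).
Proof. by move=> ip; exists p. Qed.

Lemma codP (i : idx) x : cod (atlas i) x ->
  dom (atlas i) (param (atlas i) x) /\ coord (atlas i) (param (atlas i) x) = x.
Proof. by move=> [p ip <-]; rewrite coordK. Qed.

Lemma near_param (i : idx) p (P : M -> Prop) : dom (atlas i) p ->
  (\forall q \near p, P q) ->
  \forall x \near coord (atlas i) p, P (param (atlas i) x).
Proof.
move=> ip nP; have := param_continuous (cod_coord ip).
by rewrite /prop_for /continuous_at coordK//; apply.
Qed.

Lemma near_coord (i : idx) p (P : M -> Prop) : dom (atlas i) p ->
  (\forall x \near coord (atlas i) p, P (param (atlas i) x)) ->
  \forall q \near p, P q.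
Proof.
move=> ip nP; have nd : \forall q \near p, dom (atlas i) q.
  by apply: open_nbhs_nbhs; split => //; exact: dom_open.
have := chart_continuous ip nP; rewrite /= => nP'.
by apply: filterS (filterI nd nP') => q [iq] /=; rewrite coordK.
Qed.

(** The chain rule for the transition map. *)
Lemma derive_change (W : normedModType R) (F : M -> W) (i j : idx) p v :
  dom (atlas i) p -> dom (atlas j) p ->
  differentiable (F \o param (atlas j)) (coord (atlas j) p) ->
  'D_v (F \o param (atlas i)) (coord (atlas i) p) =
  'D_(v *m change_of_basis i j p) (F \o param (atlas j)) (coord (atlas j) p).
Proof.
move=> ip jp dF; pose T := coord (atlas j) \o param (atlas i).
have dT : differentiable T (coord (atlas i) p).
  by have [+ _] := transition_smooth i j 1; apply; exists p.
have Tp : T (coord (atlas i) p) = coord (atlas j) p by rewrite /T /= coordK.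
have nj : \forall q \near p, dom (atlas j) q.
  by apply: open_nbhs_nbhs; split => //; exact: dom_open.
have nE : \forall x \near coord (atlas i) p,
    (F \o param (atlas i)) x = ((F \o param (atlas j)) \o T) x.
  by apply: filterS (near_param ip nj) => x jx; rewrite /T /= coordK.
have dFT : differentiable (F \o param (atlas j)) (T (coord (atlas i) p)).
  by rewrite Tp.
rewrite (near_eq_derive _ nE) (deriveE _ (differentiable_comp dT dFT)).
rewrite (diff_comp dT dFT) /= Tp (deriveE _ dF); congr ('d _ _ _).
by rewrite -(deriveE v dT) (deriveEjacobian v dT).
Qed.

Lemma smooth_chart (V : normedModType R) (F : M -> V) (i : idx) p : smooth F ->
  dom (atlas i) p -> differentiable (F \o param (atlas i)) (coord (atlas i) p).
Proof.
move=> sF ip; apply: smooth_differentiable (sF i) _; exact: cod_coord.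
Qed.

Lemma jacE n (F : M -> 'rV[R]_n) (i : idx) p v : smooth F -> dom (atlas i) p ->
  'D_v (F \o param (atlas i)) (coord (atlas i) p) = v *m jac F i p.
Proof. by move=> sF ip; rewrite deriveEjacobian//; exact: smooth_chart. Qed.

Lemma jac_change n (F : M -> 'rV[R]_n) (i j : idx) p : smooth F ->
  dom (atlas i) p -> dom (atlas j) p ->
  jac F i p = change_of_basis i j p *m jac F j p.
Proof.
move=> sF ip jp; apply/row_matrixP => k; rewrite !rowE.
rewrite -jacE// (derive_change _ ip jp); last exact: smooth_chart.
by rewrite jacE// mulmxA.
Qed.

Lemma change_of_basis_unit (i j : idx) p : dom (atlas i) p -> dom (atlas j) p ->
  change_of_basis i j p \in unitmx.
Proof.
by move=> ip jp; rewrite unitmxE unitfE gt_eqF// transition_oriented.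
Qed.

Lemma smooth_continuous_at (u : M -> R^o) p : smooth u -> {for p, continuous u}.
Proof.
move=> su; have ip := chart_atP p; set i := chart_at p in ip.
apply/(@cvgrPdist_lt _ R^o) => e e0.
apply: (near_coord ip).
have := smooth_near_dist (su i) (cod_coord ip) e0.
by rewrite /= coordK.
Qed.

Lemma smooth_fun_entry n (F : M -> 'rV[R]_n) c : smooth F ->
  smooth (fun p => F p 0 c : R^o).
Proof. by move=> sF i; exact: (@smooth_entry _ _ _ (open_cod i) 1 n (F \o param (atlas i)) 0 c (sF i)). Qed.

End ChartCalculus.
Arguments open_cod {R m M} i.

Section SmoothMatrices.
Variables (R : realType) (V : normedModType R) (D : set V).
Hypothesis oD : open D.

Lemma smooth_det p (A : V -> 'M[R]_p) :
  (forall i j, smooth_on D (fun x => A x i j : R^o)) ->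
  smooth_on D (fun x => \det (A x) : R^o).
Proof.
move=> sA; apply: (@eq_on_smooth _ _ _ oD _
  (\sum_(s : 'S_p) (cst ((-1) ^+ s) * \prod_i (fun x => A x i (s i) : R^o)) : V -> R^o)).
  move=> x _; rewrite fct_sumE /determinant; apply: eq_bigr => s _.
  by rewrite fctE fct_prodE.
apply: smooth_sum => // s _; apply: smoothM => //; first exact: smooth_cst.
by apply: smooth_prod => // i _; exact: sA.
Qed.

Lemma smooth_mulmx p q r (A : V -> 'M[R]_(p, q)) (B : V -> 'M[R]_(q, r)) :
  (forall i j, smooth_on D (fun x => A x i j : R^o)) ->
  (forall i j, smooth_on D (fun x => B x i j : R^o)) ->
  forall i j, smooth_on D (fun x => (A x *m B x) i j : R^o).
Proof.
move=> sA sB i j; apply: (@eq_on_smooth _ _ _ oD _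
  (\sum_k (fun x => A x i k : R^o) * (fun x => B x k j : R^o))).
  by move=> x _; rewrite fct_sumE mxE.
by apply: smooth_sum => // k _; exact: smoothM.
Qed.

(** By Cramer's formula. *)
Lemma smooth_invmx p (A : V -> 'M[R]_p) :
  (forall x, D x -> A x \in unitmx) ->
  (forall i j, smooth_on D (fun x => A x i j : R^o)) ->
  forall i j, smooth_on D (fun x => invmx (A x) i j : R^o).
Proof.
move=> uA sA i j; have sdet := smooth_det sA.
apply: (@eq_on_smooth _ _ _ oD _ ((fun x => (\det (A x))^-1 : R^o) *
   (cst ((-1) ^+ (j + i)) * (fun x => \det (row' j (col' i (A x))) : R^o)))).
  by move=> x Dx; rewrite /invmx uA// !mxE.
apply: smoothM => //.
  by apply: smoothV => // x Dx; have := uA x Dx; rewrite unitmxE unitfE.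
apply: smoothM => //; first exact: smooth_cst.
apply: smooth_det => k l.
have -> : (fun x => row' j (col' i (A x)) k l : R^o) =
          (fun x => A x (lift j k) (lift i l) : R^o).
  by apply/funext => x; rewrite !mxE.
exact: sA.
Qed.

End SmoothMatrices.

(** * Tangential derivatives *)

Section SmoothFunctionRing.
Variables (R : realType) (m : nat) (M : orientedManifold R m).

Definition smooth_pred : {pred (M -> R)} :=
  mem [set u : M -> R | smooth (u : M -> R^o)].

(** A commutative ring, on which the tangential derivatives are derivations. *)
Record smooth_fun := SmoothFun {
  smooth_val :> M -> R;
  _ : smooth_val \in smooth_pred
}.

HB.instance Definition _ := [isSub for smooth_val].
HB.instance Definition _ := [Choice of smooth_fun by <:].

Lemma smooth_predP (u : M -> R) :
  reflect (smooth (u : M -> R^o)) (u \in smooth_pred).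
Proof. by apply: (iffP idP) => [/set_mem|su]//; exact: mem_set. Qed.

Lemma smooth_subring_closed : subring_closed smooth_pred.
Proof.
split=> [|u w /smooth_predP su /smooth_predP sw|u w /smooth_predP su /smooth_predP sw];
  apply/smooth_predP => i.
- exact: (@smooth_cst R _ (cod (atlas i)) R^o 1).
- exact: (smoothD (open_cod i) (su i) (smoothN (open_cod i) (sw i))).
- exact: (smoothM (open_cod i) (su i) (sw i)).
Qed.

HB.instance Definition _ := GRing.SubChoice_isSubComPzRing.Build
  (M -> R) smooth_pred smooth_fun smooth_subring_closed.

Lemma smooth_funP (u : smooth_fun) : smooth (u : M -> R^o).
Proof. by case: u => u /= /smooth_predP. Qed.

Definition to_smooth (u : M -> R) (su : smooth (u : M -> R^o)) : smooth_fun :=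
  SmoothFun (introT (smooth_predP u) su).

Lemma smooth_fun_inj (u w : smooth_fun) : (forall p, u p = w p) -> u = w.
Proof. by move=> uw; apply/val_inj/funext. Qed.

Lemma sum_smoothE (I : Type) (r : seq I) (P : pred I) (F : I -> smooth_fun) p :
  (\sum_(i <- r | P i) F i) p = \sum_(i <- r | P i) F i p.
Proof.
have -> : (\sum_(i <- r | P i) F i) p = (\sum_(i <- r | P i) \val (F i)) p.
  by rewrite -rmorph_sum.
by rewrite fct_sumE.
Qed.

End SmoothFunctionRing.

Section TangentialDerivatives.
Variables (R : realType) (m : nat) (M : riemannianManifold R m).
Variables (phi xi : M -> 'rV[R]_m.+1).
Hypothesis hphi : isometric_immersion phi.
Hypothesis hxi : unit_normal phi xi.
Local Notation idx := (atlas_index M).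

Let sphi : smooth phi. Proof. by have [] := hphi. Qed.
Let sxi : smooth xi. Proof. by have [] := hxi. Qed.

(** Row [a] holds the components, in chart [i], of the tangential part of the
    [a]-th vector of the standard basis. *)
Definition tang (i : idx) (p : M) : 'M[R]_(m.+1, m) :=
  (jac phi i p)^T *m invmx (metric i p).

Lemma metric_jac (i : idx) p : dom (atlas i) p ->
  metric i p = jac phi i p *m (jac phi i p)^T.
Proof.
move=> ip; have [_ _ gphi] := hphi; apply/matrixP => k l.
have := gphi i p ip (delta_mx 0 k) (delta_mx 0 l).
rewrite dotE trmx_mul !mulmxA -!(mulmxA (delta_mx 0 k)) -rowE => h.
by move: h; rewrite trmx_delta -rowE -!colE !mxE => ->.
Qed.

Lemma jac_tang (i : idx) p : dom (atlas i) p -> jac phi i p *m tang i p = 1%:M.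
Proof. by move=> ip; rewrite mulmxA -metric_jac// mulmxV// metric_unit. Qed.

Lemma jac_normal (i : idx) p : dom (atlas i) p ->
  jac phi i p *m (xi p)^T = 0.
Proof.
move=> ip; have [_ _ nxi] := hxi.
apply/row_matrixP => k; rewrite row0 rowE mulmxA; apply/rowP => z.
by rewrite ord1 [RHS]mxE -dotE nxi.
Qed.

Lemma normal_tang (i : idx) p : dom (atlas i) p -> xi p *m tang i p = 0.
Proof.
move=> ip; rewrite mulmxA; have -> : xi p *m (jac phi i p)^T = 0.
  by apply: trmx_inj; rewrite trmx_mul trmxK jac_normal// trmx0.
by rewrite mul0mx.
Qed.

Lemma normal_normal p : xi p *m (xi p)^T = 1%:M.
Proof.
have [_ uxi _] := hxi.
by apply/matrixP => a b; rewrite !ord1 -dotE uxi mxE.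
Qed.

(** Both sides vanish on the normal and fix the tangent space. *)
Lemma tang_jac (i : idx) p : dom (atlas i) p ->
  tang i p *m jac phi i p = tangent_proj (xi p).
Proof.
move=> ip; pose Q := col_mx (jac phi i p) (xi p).
have QQ : Q *m Q^T = block_mx (metric i p) 0 0 1%:M.
  rewrite tr_col_mx mul_col_row -metric_jac// jac_normal// normal_normal.
  congr block_mx; apply: trmx_inj.
  by rewrite trmx_mul trmxK jac_normal// !trmx0.
have rQ : row_free Q^T.
  have rk : \rank (Q *m Q^T) = (m + 1)%N.
    rewrite QQ mxrank_unit// unitmxE det_ublock det1 mulr1 -unitmxE.
    exact: metric_unit.
  rewrite /row_free mxrank_tr eqn_leq rank_leq_col /=.
  by apply: leq_trans (mxrankM_maxl Q Q^T); rewrite rk addn1.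
apply/eqP; rewrite -subr_eq0; apply/eqP.
set B := _ - _; apply/eqP; rewrite -(mulmx_free_eq0 B rQ); apply/eqP.
rewrite tr_col_mx mul_mx_row.
have -> : B *m (jac phi i p)^T = 0.
  rewrite /B /tangent_proj !mulmxBl mul1mx -!mulmxA -metric_jac//.
  rewrite mulVmx ?metric_unit// mulmx1.
  have -> : xi p *m (jac phi i p)^T = 0.
    by apply: trmx_inj; rewrite trmx_mul trmxK jac_normal// trmx0.
  by rewrite mulmx0 subr0 subrr.
have -> : B *m (xi p)^T = 0.
  rewrite /B /tangent_proj !mulmxBl mul1mx -!mulmxA jac_normal//.
  by rewrite normal_normal !mulmx0 mulmx1 subrr subr0.
by rewrite row_mx0.
Qed.

(** With [C] the change of basis, the Jacobian matrices satisfy [J_i = C J_j] and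
    the metrics [g_i = C g_j C^T]. *)
Lemma tang_change (i j : idx) p : dom (atlas i) p -> dom (atlas j) p ->
  tang i p *m change_of_basis i j p = tang j p.
Proof.
move=> ip jp; set C := change_of_basis i j p.
have uC : C^T \in unitmx by rewrite unitmx_tr change_of_basis_unit.
have E : tang i p *m C *m metric j p *m C^T = (jac phi j p)^T *m C^T.
  rewrite -trmx_mul -(jac_change sphi ip jp) -(mulmxA (tang i p)).
  rewrite -(mulmxA (tang i p)) -metric_compat//.
  by rewrite /tang -mulmxA mulVmx ?mulmx1// metric_unit.
have {}E : tang i p *m C *m metric j p = (jac phi j p)^T.
  by apply: (can_inj (mulmxK uC)).
by rewrite [RHS]/tang -E mulmxK// metric_unit.
Qed.

Lemma smooth_jac (F : M -> 'rV[R]_m.+1) (i : idx) k a : smooth F ->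
  smooth_on (cod (atlas i)) (fun x => jac F i (param (atlas i) x) k a : R^o).
Proof.
move=> sF; apply: (@eq_on_smooth _ _ _ (open_cod i) _
  (fun x => 'D_(delta_mx 0 k) (F \o param (atlas i)) x 0 a : R^o)).
  move=> x /codP[ip px]; rewrite -{1}px jacE//.
  by rewrite -rowE mxE.
by apply: (smooth_entry (open_cod i)); exact: (smooth_derive _ (sF i)).
Qed.

Lemma smooth_tang (i : idx) a k :
  smooth_on (cod (atlas i)) (fun x => tang i (param (atlas i) x) a k : R^o).
Proof.
apply: (smooth_mulmx (open_cod i)) => [b l|l q].
  have -> : (fun x => (jac phi i (param (atlas i) x))^T b l : R^o) =
      (fun x => jac phi i (param (atlas i) x) l b : R^o).
    by apply/funext => x; rewrite mxE.
  exact: smooth_jac.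
apply: (smooth_invmx (open_cod i)) => [x /codP[ip _]|b c]; first exact: metric_unit.
exact: (smooth_entry (open_cod i) _ _ (metric_smooth i)).
Qed.

Definition tang_field (i : idx) (a : 'I_m.+1) (x : 'rV[R]_m) : 'rV[R]_m :=
  row a (tang i (param (atlas i) x)).

Lemma smooth_tang_field (i : idx) a : smooth_vect (cod (atlas i)) (tang_field i a).
Proof.
move=> k; have -> : (fun x => tang_field i a x 0 k : R^o) =
    (fun x => tang i (param (atlas i) x) a k : R^o).
  by apply/funext => x; rewrite mxE.
exact: smooth_tang.
Qed.

(** The chart around [p] is immaterial, see [tderE]. *)
Definition tder (a : 'I_m.+1) (u : M -> R^o) : M -> R^o := fun p =>
  'D_(row a (tang (chart_at p) p)) (u \o param (atlas (chart_at p)))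
    (coord (atlas (chart_at p)) p).

Lemma tderE (i : idx) a (u : M -> R^o) p : smooth u -> dom (atlas i) p ->
  tder a u p =
  'D_(row a (tang i p)) (u \o param (atlas i)) (coord (atlas i) p).
Proof.
move=> su ip; rewrite /tder; have cp := chart_atP p.
rewrite (derive_change _ cp ip); last exact: smooth_chart.
by rewrite -row_mul tang_change.
Qed.

Lemma tder_vderiv (i : idx) a (u : M -> R^o) x : smooth u -> cod (atlas i) x ->
  tder a u (param (atlas i) x) = vderiv (tang_field i a) (u \o param (atlas i)) x.
Proof. by move=> su /codP[ip px]; rewrite (tderE a su ip) px. Qed.

Lemma smooth_tder a (u : M -> R^o) : smooth u -> smooth (tder a u).
Proof.
move=> su i; apply: (@eq_on_smooth _ _ _ (open_cod i) _
  (vderiv (tang_field i a) (u \o param (atlas i)))).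
  by move=> x xi'; rewrite /= tder_vderiv.
by apply: (smooth_vderiv (open_cod i)); [exact: smooth_tang_field|exact: su].
Qed.

Lemma tder2_vderiv (i : idx) a b (u : M -> R^o) x : smooth u -> cod (atlas i) x ->
  tder a (tder b u) (param (atlas i) x) =
  vderiv (tang_field i a) (vderiv (tang_field i b) (u \o param (atlas i))) x.
Proof.
move=> su Dx; rewrite (tder_vderiv a (smooth_tder b su) Dx).
by apply: (eq_on_vderiv (open_cod i)) => // y Dy; exact: tder_vderiv.
Qed.

(** A tangent vector is the tangential part of its own image. *)
Lemma derive_tder (i : idx) (u : M -> R^o) p v : smooth u -> dom (atlas i) p ->
  'D_v (u \o param (atlas i)) (coord (atlas i) p) =
  \sum_c (v *m jac phi i p) 0 c * tder c u p.
Proof.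
move=> su ip; have du := smooth_chart su ip.
under eq_bigr do rewrite (tderE _ su ip).
rewrite deriveE// -[v in LHS]mulmx1 -(jac_tang ip) mulmxA.
rewrite mulmx_sum_row linear_sum; apply: eq_bigr => c _.
by rewrite linearZ /= deriveE.
Qed.

End TangentialDerivatives.

(** * Derivations of the ring of smooth functions *)

Section SmoothFunctionValues.
Variables (R : realType) (m : nat) (M : orientedManifold R m).
Implicit Types u w : smooth_fun M.

Lemma smooth_addE u w p : (u + w) p = u p + w p.
Proof.
have : \val (u + w) = \val u + \val w by exact: (raddfD (\val : smooth_fun M -> M -> R)).
by move=> /(congr1 (@^~ p)).
Qed.

Lemma smooth_oppE u p : (- u) p = - u p.
Proof.
have : \val (- u) = - \val u by exact: (raddfN (\val : smooth_fun M -> M -> R)).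
by move=> /(congr1 (@^~ p)).
Qed.

Lemma smooth_mulE u w p : (u * w) p = u p * w p.
Proof.
have : \val (u * w) = \val u * \val w by exact: (rmorphM (\val : smooth_fun M -> M -> R)).
by move=> /(congr1 (@^~ p)).
Qed.

Lemma smooth_oneE p : (1 : smooth_fun M) p = 1.
Proof.
have : \val (1 : smooth_fun M) = 1 by exact: (rmorph1 (\val : smooth_fun M -> M -> R)).
by move=> /(congr1 (@^~ p)).
Qed.

Lemma smooth_zeroE p : (0 : smooth_fun M) p = 0.
Proof.
have : \val (0 : smooth_fun M) = 0 by exact: (raddf0 (\val : smooth_fun M -> M -> R)).
by move=> /(congr1 (@^~ p)).
Qed.

Lemma smooth_natE n p : (n%:R : smooth_fun M) p = n%:R.
Proof. 
elim: n => [|n IH]; first by rewrite mulr0n smooth_zeroE.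
by rewrite -!natr1 smooth_addE IH smooth_oneE.
Qed.

Lemma smooth_cst_fun (c : R) : smooth (cst c : M -> R^o).
Proof. by move=> i; exact: (@smooth_cst R _ (cod (atlas i)) R^o c). Qed.

Definition const_fun (c : R) : smooth_fun M := to_smooth (smooth_cst_fun c).

End SmoothFunctionValues.

Section FrameOnHypersurface.
Variables (R : realType) (m : nat) (M : riemannianManifold R m).
Variables (phi xi : M -> 'rV[R]_m.+1).
Hypothesis hphi : isometric_immersion phi.
Hypothesis hxi : unit_normal phi xi.
Local Notation idx := (atlas_index M).
Local Notation K := (smooth_fun M).

Let sphi : smooth phi. Proof. by have [] := hphi. Qed.
Let sxi : smooth xi. Proof. by have [] := hxi. Qed.

Definition tangential_d (a : 'I_m.+1) (u : K) : K :=
  to_smooth (smooth_tder hphi a (smooth_funP u)).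
Definition position_coord (a : 'I_m.+1) : K := to_smooth (smooth_fun_entry a sphi).
Definition normal_coord (a : 'I_m.+1) : K := to_smooth (smooth_fun_entry a sxi).

Local Notation d_ := tangential_d.
Local Notation x_ := position_coord.
Local Notation nu_ := normal_coord.

Lemma d_E (i : idx) a (u : K) p : dom (atlas i) p -> d_ a u p =
  'D_(row a (tang phi i p)) (u \o param (atlas i)) (coord (atlas i) p).
Proof. by move=> ip; rewrite /= (tderE hphi a (smooth_funP u) ip). Qed.

Lemma d_D a (u w : K) : d_ a (u + w) = d_ a u + d_ a w.
Proof.
apply: smooth_fun_inj => p; have ip := chart_atP p.
rewrite smooth_addE !(d_E _ _ ip).
set X := (X in 'D_X _ _); set i := chart_at p.
have -> : (u + w : K) \o param (atlas i) =
    ((u : M -> R^o) \o param (atlas i)) + ((w : M -> R^o) \o param (atlas i)).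
  by apply/funext => x; exact: smooth_addE.
have su := smooth_chart (smooth_funP u) ip.
have sw := smooth_chart (smooth_funP w) ip.
by rewrite deriveD//; exact: diff_derivable.
Qed.

Lemma d_M a (u w : K) : d_ a (u * w) = u * d_ a w + w * d_ a u.
Proof.
apply: smooth_fun_inj => p; have ip := chart_atP p.
rewrite smooth_addE !smooth_mulE !(d_E _ _ ip).
set X := (X in 'D_X _ _); set i := chart_at p.
have -> : (u * w : K) \o param (atlas i) =
    ((u : M -> R^o) \o param (atlas i)) * ((w : M -> R^o) \o param (atlas i)).
  by apply/funext => x; exact: smooth_mulE.
have su := smooth_chart (smooth_funP u) ip.
have sw := smooth_chart (smooth_funP w) ip.
rewrite deriveM; try exact: diff_derivable.
by rewrite /= coordK.
Qed.

Lemma d_const a (c : R) : d_ a (const_fun M c) = 0.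
Proof.
apply: smooth_fun_inj => p; rewrite (d_E _ _ (chart_atP p)) smooth_zeroE.
rewrite (_ : _ \o _ = cst c :> (_ -> R^o))//; exact: derive_cst.
Qed.

Lemma d_vec (F : M -> 'rV[R]_m.+1) (sF : smooth F) (i : idx) a b p :
  dom (atlas i) p -> d_ a (to_smooth (smooth_fun_entry b sF)) p =
  (tang phi i p *m jac F i p) a b.
Proof.
move=> ip; rewrite (d_E _ _ ip) /=.
have := derive_entry 0 b (row a (tang phi i p)) (sF i) (cod_coord ip).
by rewrite /comp/= => ->; rewrite jacE// -row_mul mxE.
Qed.

Lemma nu_nu : \sum_a nu_ a * nu_ a = 1.
Proof.
apply: smooth_fun_inj => p; rewrite sum_smoothE smooth_oneE.
have [_ uxi _] := hxi; rewrite -[RHS](uxi p).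
by apply: eq_bigr => a _; rewrite smooth_mulE.
Qed.

Lemma nu_d u : \sum_a nu_ a * d_ a u = 0.
Proof.
apply: smooth_fun_inj => p; rewrite sum_smoothE smooth_zeroE.
have ip := chart_atP p; set i := chart_at p in ip.
have du := smooth_chart (smooth_funP u) ip.
transitivity ('D_(xi p *m tang phi i p) ((u : M -> R^o) \o param (atlas i))
   (coord (atlas i) p)).
  rewrite mulmx_sum_row deriveE// linear_sum; apply: eq_bigr => a _.
  by rewrite smooth_mulE (d_E _ _ ip) linearZ /= deriveE.
by rewrite (normal_tang hxi ip) derive0.
Qed.

Lemma nu_d_nu a : \sum_c nu_ c * d_ a (nu_ c) = 0.
Proof.
have : d_ a (\sum_c nu_ c * nu_ c) = 0 by rewrite nu_nu (deriv1 d_M).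
rewrite (deriv_sum d_D) => E; apply: smooth_fun_inj => p.
have : (\sum_c d_ a (nu_ c * nu_ c)) p = 0 by rewrite E smooth_zeroE.
rewrite !sum_smoothE smooth_zeroE.
have -> : \sum_c (d_ a (nu_ c * nu_ c)) p = 2 * \sum_c (nu_ c * d_ a (nu_ c)) p.
  rewrite mulr_sumr; apply: eq_bigr => c _.
  by rewrite d_M smooth_addE mulr_natl mulr2n.
by move=> /eqP; rewrite mulf_eq0 pnatr_eq0 /= => /eqP.
Qed.

Lemma d_x a b : d_ a (x_ b) = (a == b)%:R - nu_ a * nu_ b.
Proof.
apply: smooth_fun_inj => p; have ip := chart_atP p.
rewrite (d_vec sphi _ _ ip) (tang_jac hphi hxi ip) smooth_addE smooth_oppE.
rewrite smooth_natE smooth_mulE /tangent_proj mxE [in LHS]mxE; congr (_ + _).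
by rewrite mxE; congr (- _); rewrite mxE big_ord1 mxE.
Qed.

Let br a b u := d_ a (d_ b u) - d_ b (d_ a u).

(** In a chart the bracket is a combination of partial derivatives, so it
    differentiates along a tangent vector. *)
Lemma bracket_tangent a b p : exists z : 'rV[R]_m.+1,
  dot z (xi p) = 0 /\ forall u : K, br a b u p = \sum_c z 0 c * d_ c u p.
Proof.
have ip := chart_atP p; set i := chart_at p in ip.
have sX := smooth_tang_field hphi i.
have [Z ZP] := vderiv_bracket (open_cod i) (sX a) (sX b) (cod_coord ip).
exists (Z *m jac phi i p); split.
  by rewrite dotE -mulmxA (jac_normal hxi ip) mulmx0 mxE.
move=> u; rewrite -(derive_tder hphi _ (smooth_funP u) ip) -(ZP _ (smooth_funP u i)).
by rewrite -!(tder2_vderiv hphi _ _ (smooth_funP u) (cod_coord ip)) coordK.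
Qed.

Lemma bracket_x a b u : br a b u = \sum_c br a b (x_ c) * d_ c u.
Proof.
apply: smooth_fun_inj => p; rewrite sum_smoothE.
have [z [znu zE]] := bracket_tangent a b p.
rewrite zE; apply: eq_bigr => c _; rewrite smooth_mulE zE; congr (_ * _).
under eq_bigr do rewrite d_x smooth_addE smooth_oppE smooth_natE smooth_mulE mulrBr.
rewrite sumrB (bigD1 c)//= eqxx mulr1 big1 ?addr0; last first.
  by move=> e /negPf ec; rewrite ec mulr0.
have -> : \sum_i z 0 i * (xi p 0 i * xi p 0 c) = dot z (xi p) * xi p 0 c.
  by rewrite mulr_suml; apply: eq_bigr => e _; rewrite mulrA.
by rewrite znu mul0r subr0.
Qed.

Lemma bracket_nu a b : \sum_c nu_ c * br a b (x_ c) = 0.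
Proof.
apply: smooth_fun_inj => p; rewrite sum_smoothE smooth_zeroE.
have [z [znu zE]] := bracket_tangent a b p.
transitivity (\sum_c \sum_e (z 0 e * xi p 0 c) * d_ e (x_ c) p).
  apply: eq_bigr => c _; rewrite smooth_mulE zE mulr_sumr.
  by apply: eq_bigr => e _; rewrite mulrCA mulrA.
rewrite exchange_big big1//= => e _.
transitivity (z 0 e * (\sum_c nu_ c * d_ e (x_ c)) p).
  rewrite sum_smoothE mulr_sumr; apply: eq_bigr => c _.
  by rewrite smooth_mulE mulrA.
suff -> : \sum_c nu_ c * d_ e (x_ c) = 0 by rewrite smooth_zeroE mulr0.
under eq_bigr do rewrite d_x mulrBr.
rewrite sumrB (bigD1 e)//= eqxx mulr1 big1 ?addr0; last first.
  by move=> c /negPf ec; rewrite eq_sym ec mulr0.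
under eq_bigr do rewrite mulrCA.
by rewrite -mulr_sumr nu_nu mulr1 subrr.
Qed.

End FrameOnHypersurface.

(** * Maximum principles on the hypersurface *)

Section Connectedness.
Variables (R : realType) (m : nat) (M : orientedManifold R m).

Lemma connected_ind (Q : set M) p0 : Q p0 ->
  (forall p, Q p -> \forall q \near p, Q q) -> closed Q -> forall p, Q p.
Proof.
move=> Q0 oQ cQ p; suff -> : Q = [set: M] by [].
apply: (@manifold_connected _ _ M).
- by exists p0.
- by exists Q; rewrite ?setTI// openE => q /oQ.
- by exists Q; rewrite ?setTI.
Qed.

Lemma continuous_smooth_fun (u : smooth_fun M) : continuous (u : M -> R).
Proof. by move=> p; exact: (smooth_continuous_at (smooth_funP u)). Qed.

Lemma closed_level (u : smooth_fun M) c : closed [set p | u p = c].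
Proof.
apply: (@closed_comp _ _ (u : M -> R) [set y | y = c]); last exact: closed_eq.
by move=> p _; exact: continuous_smooth_fun.
Qed.

Lemma smooth_max (u : smooth_fun M) : compact [set: M] -> [set: M] !=set0 ->
  exists p, forall q, u q <= u p.
Proof.
move=> cM M0; have [] := @compact_EVT_max M R u setT M0 cM.
  exact/continuous_subspaceT/continuous_smooth_fun.
by move=> p _ pmax; exists p => q; apply: pmax; rewrite inE.
Qed.

End Connectedness.

Section MaximumPrinciples.
Variables (R : realType) (m : nat) (M : riemannianManifold R m).
Variables (phi xi : M -> 'rV[R]_m.+1).
Hypothesis hphi : isometric_immersion phi.
Local Notation idx := (atlas_index M).
Local Notation K := (smooth_fun M).
Local Notation d_ := (tangential_d hphi).

Lemma tang_span (i : idx) x (e : 'rV[R]_m) : cod (atlas i) x -> e != 0 ->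
  exists a, dot (tang_field phi i a x) e != 0.
Proof.
move=> /codP[ip px] e0; apply: contrapT => nex; move/eqP: e0; apply.
apply: trmx_inj; rewrite -[e^T]mul1mx -(jac_tang hphi ip) -mulmxA.
suff -> : tang phi i (param (atlas i) x) *m e^T = 0 by rewrite mulmx0 trmx0.
apply/row_matrixP => a; rewrite row0 row_mul; apply/rowP => z.
rewrite ord1 [RHS]mxE -dotE; apply/eqP/negPn/negP => ne.
by apply: nex; exists a.
Qed.

Lemma near_max_chart (i : idx) (u : M -> R) p : dom (atlas i) p ->
  (\forall q \near p, u q <= u p) ->
  \forall x \near coord (atlas i) p,
    (u \o param (atlas i)) x <= (u \o param (atlas i)) (coord (atlas i) p).
Proof. by move=> ip up; have := near_param ip up; rewrite /= coordK. Qed.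

(** The set of maximum points is closed, and it is open by the strong maximum
    principle in a chart. *)
Lemma subharmonic_cst (u : K) p0 : (forall p, 0 <= (\sum_c d_ c (d_ c u)) p) ->
  (forall p, u p <= u p0) -> forall p, u p = u p0.
Proof.
move=> Lu umax; apply: (@connected_ind _ _ M [set p | u p = u p0] p0) => //; last first.
  exact: closed_level.
move=> p /= up; have ip := chart_atP p; set i := chart_at p in ip.
apply: (near_coord ip).
have sX := smooth_tang_field hphi i.
apply: (@strong_maximum _ _ _ (cod (atlas i)) (tang_field phi i) (open_cod i) sX _
  ((u : M -> R^o) \o param (atlas i)) (u p0) (coord (atlas i) p)).
- by move=> x e; exact: tang_span.
- exact: (smooth_funP u i).
- move=> x Dx; rewrite sumsqE.
  have E a := tder2_vderiv hphi a a (smooth_funP u) Dx.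
  under eq_bigr do rewrite -E.
  by have := Lu (param (atlas i) x); rewrite sum_smoothE.
- by move=> x _; exact: umax.
- exact: cod_coord.
- by rewrite /= coordK.
Qed.

Lemma d_at_max (u : K) p a : (\forall q \near p, u q <= u p) -> d_ a u p = 0.
Proof.
move=> up; have ip := chart_atP p; rewrite (d_E hphi _ _ ip).
apply: (derive_at_max (open_cod (chart_at p))) => //.
- exact: (smooth_funP u).
- exact: cod_coord.
- exact: near_max_chart.
Qed.

(** [\sum_a v_a d_a] is a smooth tangent field; its square is nonpositive at a
    maximum. *)
Lemma hess_at_max (u : K) p (v : 'rV[R]_m.+1) : (\forall q \near p, u q <= u p) ->
  \sum_a \sum_b v 0 a * v 0 b * d_ a (d_ b u) p <= 0.
Proof.
move=> up; have ip := chart_atP p; set i := chart_at p in ip.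
pose X x := v *m tang phi i (param (atlas i) x).
have sX : smooth_vect (cod (atlas i)) X.
  move=> k; apply: (smooth_mulmx (open_cod i)).
    by move=> a b; exact: (smooth_cst _ (v a b : R^o)).
  by move=> a b; exact: (smooth_tang hphi).
have XE (w : K) x : cod (atlas i) x ->
    vderiv X ((w : M -> R^o) \o param (atlas i)) x =
    (\sum_a const_fun M (v 0 a) * d_ a w) (param (atlas i) x).
  move=> Dx; have dw := smooth_differentiable (smooth_funP w i) Dx.
  rewrite /vderiv {1}/X mulmx_sum_row deriveE// linear_sum sum_smoothE.
  apply: eq_bigr => a _; rewrite linearZ smooth_mulE.
  have [iq px] := codP Dx.
  by rewrite (d_E hphi _ _ iq) px -deriveE.
have := vderiv2_at_max (open_cod i) sX (smooth_funP u i) (cod_coord ip)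
  (near_max_chart ip up).
rewrite (eq_on_vderiv (open_cod i) X (XE u) (cod_coord ip)).
rewrite (XE _ _ (cod_coord ip)) coordK// sum_smoothE.
congr (_ <= _); apply: eq_bigr => a _.
rewrite smooth_mulE (deriv_sum (d_D hphi)) sum_smoothE mulr_sumr.
apply: eq_bigr => b _.
rewrite (d_M hphi) smooth_addE !smooth_mulE (d_const hphi) smooth_zeroE mulr0 addr0.
by rewrite mulrA.
Qed.

(** The mean value theorem on the segments of a ball in a chart. *)
Lemma near_cst (u : K) p : (\forall q \near p, forall a, d_ a u q = 0) ->
  \forall q \near p, u q = u p.
Proof.
move=> du; have ip := chart_atP p; set i := chart_at p in ip.
apply: (near_coord ip); set x0 := coord (atlas i) p.
have Dx0 : cod (atlas i) x0 by exact: cod_coord.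
have : nbhs x0 [set x | (forall a, d_ a u (param (atlas i) x) = 0) /\
    cod (atlas i) x].
  exact: filterI (near_param ip du) (near_open (open_cod i) Dx0).
move=> /nbhs_ballP[e e0 eP]; apply/nbhs_ballP; exists e => // x xe.
have inB t : 0 <= t <= 1 -> ball x0 e (x0 + t *: (x - x0)).
  move=> /andP[t0 t1]; rewrite -ball_normE /ball_ /= opprD addNKr normrN normrZ.
  move: xe; rewrite -ball_normE /ball_ /= distrC; apply: le_lt_trans.
  by rewrite ger0_norm// ler_piMl.
pose w : 'rV[R]_m -> R^o := (u : M -> R^o) \o param (atlas i).
have dw t : 0 <= t <= 1 -> derivable w (x0 + t *: (x - x0)) (x - x0).
  move=> /inB/eP[_ Dt]; exact: smooth_derivable (smooth_funP u i) Dt.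
have [c /andP[c0 c1]] := line_MVT ltr01 dw.
rewrite scale1r [x0 + _]addrC subrK => /eqP; rewrite subr_eq => /eqP E.
rewrite [LHS]E.
have /eP[dc Dc] : ball x0 e (x0 + c *: (x - x0)) by apply: inB; rewrite !ltW.
have [ic pc] := codP Dc.
rewrite /w -{1}pc (derive_tder hphi _ (smooth_funP u) ic) big1.
  by rewrite mulr0 add0r /= coordK.
by move=> a _; rewrite [tder _ _ _ _]dc mulr0.
Qed.

Lemma d_eq0_cst (u : K) : (forall a, d_ a u = 0) -> forall p q, u p = u q.
Proof.
move=> du p q; apply: (@connected_ind _ _ M [set p | u p = u q] q) => //.
  move=> r /= <-; apply: near_cst; near=> s => a.
  by rewrite du smooth_zeroE.
exact: closed_level.
Unshelve. all: by end_near. Qed.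

End MaximumPrinciples.

(** * The second fundamental form *)

Section SecondFundamentalForm.
Variables (R : realType) (m : nat) (M : riemannianManifold R m).
Variables (phi xi : M -> 'rV[R]_m.+1).
Hypothesis hphi : isometric_immersion phi.
Hypothesis hxi : unit_normal phi xi.
Local Notation idx := (atlas_index M).
Local Notation K := (smooth_fun M).
Local Notation d_ := (tangential_d hphi).
Local Notation nu_ := (normal_coord hxi).
Local Notation x_ := (position_coord hphi).
Local Notation S := (shape_operator phi xi).

Let sphi : smooth phi. Proof. by have [] := hphi. Qed.
Let sxi : smooth xi. Proof. by have [] := hxi. Qed.

Definition second_form (a b : 'I_m.+1) : K := - d_ a (nu_ b).

Local Notation form_ := second_form.

(** A matrix of the ambient space, hence free of charts, that is conjugate to the
    shape operator on the tangent space and kills the normal. *)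
Definition form_mx (p : M) : 'M[R]_m.+1 := \matrix_(a, b) form_ a b p.

Lemma form_mxE (i : idx) p : dom (atlas i) p ->
  form_mx p = tang phi i p *m S i p *m jac phi i p.
Proof.
move=> ip; rewrite -mulmxA -[_ *m jac phi i p]opprK -(weingarten hphi hxi ip).
rewrite mulmxN; apply/matrixP => a b; rewrite mxE smooth_oppE [RHS]mxE.
by rewrite (d_vec hphi sxi _ _ ip).
Qed.

(** The symmetry comes from the brackets of tangential derivatives. *)
Lemma form_C a b : form_ a b = form_ b a.
Proof.
exact: (form_sym (d_D hphi) (d_M hphi) (d_x hphi hxi) (nu_nu hxi)
  (nu_d_nu hphi hxi) (bracket_nu hphi hxi)).
Qed.

Lemma form_mxT p : (form_mx p)^T = form_mx p.
Proof. by apply/matrixP => a b; rewrite !mxE form_C. Qed.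

Lemma normal_form_mx p : xi p *m form_mx p = 0.
Proof.
have ip := chart_atP p; rewrite (form_mxE ip) -(mulmxA (tang _ _ _)).
by rewrite (mulmxA (xi p)) (normal_tang hxi ip) mul0mx.
Qed.

Lemma shape_form (i : idx) p : dom (atlas i) p ->
  S i p = jac phi i p *m form_mx p *m tang phi i p.
Proof.
move=> ip; rewrite (form_mxE ip) -(mulmxA (tang _ _ _)) (mulmxA (jac _ _ _)).
by rewrite (jac_tang hphi ip) mul1mx -mulmxA (jac_tang hphi ip) mulmx1.
Qed.

Lemma mean_curvatureE p :
  mean_curvature phi xi p = (m%:R)^-1 * \tr (form_mx p).
Proof.
rewrite /mean_curvature; congr (_ * _); have ip := chart_atP p.
rewrite (form_mxE ip) -mulmxA mxtrace_mulC -mulmxA.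
by rewrite (jac_tang hphi ip) mulmx1.
Qed.

Lemma shape_sqnormE p : shape_sqnorm phi xi p = \tr (form_mx p *m form_mx p).
Proof.
rewrite /shape_sqnorm; have ip := chart_atP p; set i := chart_at p in ip *.
have alg (T : 'M[R]_(m.+1, m)) (J : 'M[R]_(m, m.+1)) (A : 'M[R]_m) :
    J *m T = 1%:M -> \tr (T *m A *m J *m (T *m A *m J)) = \tr (A *m A).
  move=> JT; rewrite mxtrace_mulC !mulmxA -(mulmxA _ J T) JT mulmx1.
  by rewrite -!mulmxA mxtrace_mulC -!mulmxA JT mulmx1.
by rewrite (form_mxE ip) alg// (jac_tang hphi ip).
Qed.

Definition mean_fun : K := const_fun M (m%:R^-1) * \sum_a form_ a a.

Lemma sum_form p : (\sum_a form_ a a) p = \tr (form_mx p).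
Proof. by rewrite sum_smoothE; apply: eq_bigr => a _; rewrite mxE. Qed.

Lemma mean_funE : smooth_val mean_fun = mean_curvature phi xi.
Proof.
by apply/funext => p; rewrite smooth_mulE sum_form mean_curvatureE.
Qed.

(** Tangential derivatives are the ambient components of the gradient. *)
Lemma grad_jac (i : idx) (u : K) p : dom (atlas i) p ->
  grad (u : M -> R) i p *m jac phi i p = \row_a d_ a u p.
Proof.
move=> ip; apply/rowP => a; rewrite [RHS]mxE (d_E hphi _ _ ip).
have du := smooth_chart (smooth_funP u) ip.
rewrite (derive_coordE _ du) /grad -mulmxA mxE; apply: eq_bigr => k _.
rewrite mxE mulrC; congr (_ * _).
have -> : invmx (metric i p) *m jac phi i p = (tang phi i p)^T.
  by rewrite /tang trmx_mul trmxK trmx_inv (Defs.metric_sym ip).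
by rewrite !mxE.
Qed.

(** Where [f] does not vanish its gradient, were it nonzero, would be a principal
    direction whose curvature has the sign opposite to that of the trace. *)
Lemma biconservative_d p : (1 < m)%N ->
  (forall p : M, shape_sqnorm phi xi p <=
     m%:R ^+ 2 * mean_curvature phi xi p ^+ 2 / (m%:R - 1)) ->
  biconservative phi xi -> mean_curvature phi xi p != 0 ->
  forall a, d_ a mean_fun p = 0.
Proof.
move=> m1 pinch bicons f0; have ip := chart_atP p; set i := chart_at p in ip.
have m0 : 0 < m%:R :> R by rewrite ltr0n ltnW.
set f := mean_curvature phi xi p in f0.
have trE : \tr (form_mx p) = m%:R * f.
  by rewrite /f mean_curvatureE mulVKf// gt_eqF.
pose w := grad (mean_fun : M -> R) i p *m jac phi i p.
have wh : w *m form_mx p = (- (m%:R / 2) * f) *: w.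
  have alg (g : 'rV[R]_m) (T : 'M[R]_(m.+1, m)) (J : 'M[R]_(m, m.+1)) (A : 'M[R]_m) :
    J *m T = 1%:M -> g *m J *m (T *m A *m J) = g *m A *m J.
    by move=> JT; rewrite !mulmxA -(mulmxA g J T) JT mulmx1.
  rewrite (form_mxE ip) /w (alg _ _ _ _ (jac_tang hphi ip)).
  have := bicons i p ip; rewrite /apply_endo -mean_funE => ->.
  by rewrite -scalemxAl mean_funE.
have [_ uxi _] := hxi.
have := @pinched_semidefinite _ _ _ _ (form_mxT p) (normal_form_mx p) (uxi p) w m1.
rewrite -shape_sqnormE trE exprMn => /(_ (pinch p)).
rewrite wh -scalemxAl mxE -dotE => le0.
have w0 : w = 0.
  apply/eqP; rewrite -dot_eq0 eq_le dot_ge0 andbT.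
  have f2 : 0 < f ^+ 2 by rewrite exprn_even_gt0.
  have c0 : 0 < m%:R ^+ 2 / 2 * f ^+ 2 by rewrite mulr_gt0// divr_gt0// exprn_gt0.
  rewrite -(pmulr_rle0 _ c0) -oppr_ge0; apply: le_trans le0 _.
  by rewrite le_eqVlt; apply/orP; left; apply/eqP; field.
move=> a; have := grad_jac mean_fun ip; rewrite -/w w0 => /rowP/(_ a).
by rewrite !mxE.
Qed.

(** The set where [f] takes a given nonzero value is closed, and it is open by
    [biconservative_d]. *)
Lemma mean_curvature_cst : (1 < m)%N ->
  (forall p : M, shape_sqnorm phi xi p <=
     m%:R ^+ 2 * mean_curvature phi xi p ^+ 2 / (m%:R - 1)) ->
  biconservative phi xi -> non_minimal phi xi ->
  exists2 c : R, c != 0 & forall p, mean_curvature phi xi p = c.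
Proof.
move=> m1 pinch bicons [p0]; rewrite -mean_funE => f0.
have [c fc] : exists c, mean_fun p0 = c by exists (mean_fun p0).
exists c; first by rewrite -fc.
move: f0; rewrite fc => c0; apply: (@connected_ind _ _ M _ p0) => //; last first.
  exact: closed_level.
move=> p fp.
have dz : \forall q \near p, forall a, d_ a mean_fun q = 0.
  have nz : \forall q \near p, mean_fun q != 0.
    have op : open [set q : M | mean_fun q != 0].
      apply: (@open_comp _ _ (mean_fun : M -> R) [set y | y != 0]).
        by move=> q _; exact: continuous_smooth_fun.
      exact: open_neq.
    have fp' : mean_fun p = c := fp.
    have fp0 : mean_fun p != 0 by rewrite fp'.
    by apply: open_nbhs_nbhs; split.
  apply: filterS nz => q fq; apply: biconservative_d => //.
  by rewrite -mean_funE.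
by apply: filterS (near_cst dz) => q E; exact: etrans E fp.
Qed.

End SecondFundamentalForm.

(** * Umbilicity *)

Section ConstantMeanCurvature.
Variables (R : realType) (m : nat) (M : riemannianManifold R m).
Variables (phi xi : M -> 'rV[R]_m.+1).
Hypothesis hphi : isometric_immersion phi.
Hypothesis hxi : unit_normal phi xi.
Hypothesis cM : compact [set: M].
Hypothesis m1 : (1 < m)%N.
Variable c : R.
Hypothesis c0 : c != 0.
Hypothesis fc : forall p, mean_curvature phi xi p = c.
Hypothesis pinch : forall p : M, shape_sqnorm phi xi p <=
             m%:R ^+ 2 * mean_curvature phi xi p ^+ 2 / (m%:R - 1).
Local Notation K := (smooth_fun M).
Local Notation d_ := (tangential_d hphi).
Local Notation nu_ := (normal_coord hxi).
Local Notation x_ := (position_coord hphi).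
Local Notation form_ := (second_form hphi hxi).
Local Notation form_mx := (form_mx hphi hxi).

Let m0 : m%:R != 0 :> R. Proof. by rewrite pnatr_eq0 -lt0n ltnW. Qed.

Let trE p : \tr (form_mx p) = m%:R * c.
Proof. by rewrite -(fc p) (mean_curvatureE hphi hxi) mulVKf. Qed.

Let tr0 p : \tr (form_mx p) != 0.
Proof. by rewrite trE mulf_neq0. Qed.

Let pinch_mx p : \tr (form_mx p *m form_mx p) <= \tr (form_mx p) ^+ 2 / (m%:R - 1).
Proof. by have := pinch p; rewrite (shape_sqnormE hphi hxi) fc trE exprMn. Qed.

Let form2 a b : K := \sum_e form_ a e * form_ e b.
Let sqn : K := \sum_a \sum_b form_ a b * form_ a b.
Let cubn : K := \sum_a \sum_b form2 a b * form_ a b.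

Let form2E a b p : form2 a b p = (form_mx p *m form_mx p) a b.
Proof.
rewrite sum_smoothE mxE; apply: eq_bigr => e _; rewrite smooth_mulE.
by rewrite /form_mx !mxE.
Qed.

Let sqnE p : sqn p = \tr (form_mx p *m form_mx p).
Proof.
rewrite sum_smoothE; apply: eq_bigr => a _; rewrite sum_smoothE mxE.
apply: eq_bigr => b _; rewrite smooth_mulE /form_mx !mxE.
by rewrite [in X in _ = _ * X]form_C.
Qed.

Let cubnE p : cubn p = \tr (form_mx p *m form_mx p *m form_mx p).
Proof.
rewrite sum_smoothE; apply: eq_bigr => a _; rewrite sum_smoothE mxE.
apply: eq_bigr => b _; rewrite smooth_mulE form2E; congr (_ * _).
by rewrite [RHS]mxE form_C.
Qed.

Let d_trace b : d_ b (\sum_a form_ a a) = 0.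
Proof.
have -> : \sum_a form_ a a = const_fun M (m%:R * c).
  by apply: smooth_fun_inj => p; rewrite sum_form trE.
exact: d_const.
Qed.

(** The Simons identity at a point; [w] is the squared norm of the covariant
    derivative of the shape operator. *)
Lemma laplacian_sqn p : exists2 w : R, 0 <= w &
  (\sum_a d_ a (d_ a sqn)) p =
  (w + (\tr (form_mx p) * \tr (form_mx p *m form_mx p *m form_mx p)
        - \tr (form_mx p *m form_mx p) ^+ 2)) *+ 2.
Proof.
have [W S] : exists W : 'I_m.+1 -> 'I_m.+1 -> 'I_m.+1 -> K,
    \sum_a d_ a (d_ a sqn) = (\sum_e \sum_a \sum_b W e a b * W e a b +
      (\sum_a form_ a a) * cubn - sqn * sqn) *+ 2.
  eexists; exact: (simons (d_D hphi) (d_M hphi) (form_C hphi hxi) (nu_nu hxi)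
    (nu_d hphi hxi) (bracket_form (d_D hphi) (d_M hphi) (d_x hphi hxi) (nu_nu hxi)
    (nu_d_nu hphi hxi) (bracket_x hphi hxi) (bracket_nu hphi hxi)) d_trace).
rewrite S mulr2n smooth_addE -mulr2n smooth_addE smooth_addE smooth_oppE !smooth_mulE.
rewrite sqnE cubnE sum_form.
eexists; last by rewrite expr2 addrA.
rewrite sum_smoothE sumr_ge0// => i _; rewrite sum_smoothE sumr_ge0// => j _.
rewrite sum_smoothE sumr_ge0// => k _; rewrite smooth_mulE -expr2.
exact: sqr_ge0.
Qed.

Lemma laplacian_sqn_ge0 p : 0 <= (\sum_a d_ a (d_ a sqn)) p.
Proof.
have [w w0 ->] := laplacian_sqn p; have [_ uxi _] := hxi.
rewrite mulrn_wge0// addr_ge0// subr_ge0.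
exact: (pinched_cubic (form_mxT hphi hxi p) (normal_form_mx hphi hxi p) (uxi p)
    m1 (tr0 p) (pinch_mx p)).
Qed.

Let r2 : K := \sum_a x_ a * x_ a.
Let supp : K := \sum_a x_ a * nu_ a.

Lemma hess_r2 a b : d_ a (d_ b r2) =
  ((a == b)%:R - nu_ a * nu_ b - nu_ b * d_ a supp + supp * form_ a b) *+ 2.
Proof.
have dr e : d_ e r2 = (x_ e - nu_ e * supp) *+ 2.
  rewrite /r2 (deriv_sum (d_D hphi)).
  transitivity ((\sum_i (x_ i * (e == i)%:R - nu_ e * (x_ i * nu_ i))) *+ 2).
    by rewrite -sumrMnl; apply: eq_bigr => i _; rewrite (d_M hphi) (d_x hphi hxi); ring.
  rewrite sumrB -mulr_sumr (bigD1 e)//= eqxx mulr1 big1 ?addr0// => i /negPf ie.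
  by rewrite eq_sym ie mulr0.
rewrite dr mulr2n (d_D hphi) (derivB (d_D hphi)) (d_M hphi) (d_x hphi hxi) /second_form.
by rewrite -mulr2n; congr (_ *+ 2); ring.
Qed.

(** The hypersurface stays in the ball centred at the origin through its farthest
    point, and bends there at least as much as the bounding sphere. *)
Lemma farthest_definite p : (forall q, r2 q <= r2 p) ->
  forall v, dot v (xi p) = 0 ->
  supp p * (v *m form_mx p *m v^T) 0 0 <= - dot v v.
Proof.
move=> pmax v vxi; have np : \forall q \near p, r2 q <= r2 p by near=> q; exact: pmax.
have := hess_at_max hphi v np.
have -> : \sum_a \sum_b v 0 a * v 0 b * d_ a (d_ b r2) p =
  (dot v v + supp p * (v *m form_mx p *m v^T) 0 0) *+ 2.
  have [ds dsE] : exists ds : 'I_m.+1 -> R, forall a, d_ a supp p = ds a.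
    by exists (fun a => d_ a supp p).
  have E a b : d_ a (d_ b r2) p = ((a == b)%:R - xi p 0 a * xi p 0 b
      - xi p 0 b * ds a + supp p * form_mx p a b) *+ 2.
    rewrite hess_r2 mulr2n smooth_addE -mulr2n.
    rewrite !(smooth_addE, smooth_oppE, smooth_mulE) smooth_natE dsE.
    by rewrite [form_mx p a b]mxE.
  under eq_bigr do under eq_bigr do rewrite E.
  transitivity ((\sum_a \sum_b v 0 a * v 0 b * (a == b)%:R
     - (\sum_a v 0 a * xi p 0 a) * (\sum_b v 0 b * xi p 0 b)
     - (\sum_a v 0 a * ds a) * (\sum_b v 0 b * xi p 0 b)
     + supp p * (\sum_a \sum_b v 0 a * form_mx p a b * v 0 b)) *+ 2).
    rewrite !big_distrlr /= mulr_sumr -!sumrB -big_split -sumrMnl /=.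
    apply: eq_bigr => a _; rewrite mulr_sumr -!sumrB -big_split -sumrMnl /=.
    by apply: eq_bigr => b _; ring.
  have -> : \sum_i v 0 i * xi p 0 i = 0 by [].
  rewrite !mulr0 !subr0; congr ((_ + _ * _) *+ 2).
    apply: eq_bigr => a _; rewrite (bigD1 a)//= eqxx mulr1 big1 ?addr0// => b /negPf ba.
    by rewrite eq_sym ba mulr0.
  rewrite mxE exchange_big /=; apply: eq_bigr => b _; rewrite mxE mulr_suml.
  by apply: eq_bigr => a _; rewrite [v^T b 0]mxE.
by rewrite mulr2n; lra.
Unshelve. all: by end_near. Qed.

(** [|h|^2] is subharmonic, hence constant, so its Laplacian vanishes and
    [pinched_cubic] is an equality everywhere. At the farthest point from the
    origin this gives [|h|^2 = H^2 / m], which then holds everywhere. *)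
Theorem umbilic : [set: M] !=set0 ->
  forall p, form_mx p = c *: tangent_proj (xi p).
Proof.
move=> M0; have [_ uxi _] := hxi.
have [p1 max1] := smooth_max r2 cM M0.
have [p0 max0] := smooth_max sqn cM M0.
have sqc := subharmonic_cst laplacian_sqn_ge0 max0.
have sqcst : sqn = const_fun M (sqn p0) by apply: smooth_fun_inj => q; rewrite sqc.
have eq1 : \tr (form_mx p1) * \tr (form_mx p1 *m form_mx p1 *m form_mx p1) =
    \tr (form_mx p1 *m form_mx p1) ^+ 2.
  apply/eqP; rewrite -subr_eq0 eq_le; apply/andP; split; last first.
    rewrite subr_ge0.
    exact: (pinched_cubic (form_mxT hphi hxi p1) (normal_form_mx hphi hxi p1) (uxi p1)
      m1 (tr0 p1) (pinch_mx p1)).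
  have [w w0 E] := laplacian_sqn p1.
  have : (\sum_a d_ a (d_ a sqn)) p1 = 0.
    rewrite sqcst big1 ?smooth_zeroE// => a _.
    by rewrite d_const (deriv0 (d_D hphi)).
  rewrite E => /eqP; rewrite mulrn_eq0 /= addr_eq0 => /eqP wE.
  by rewrite -oppr_ge0 -wE.
have tr1 := definite_cubic_eq (form_mxT hphi hxi p1) (normal_form_mx hphi hxi p1)
  (uxi p1) (ltnW m1) (tr0 p1) (farthest_definite max1) eq1.
move=> p; rewrite (umbilic_of_tr (form_mxT hphi hxi p) (normal_form_mx hphi hxi p)
  (uxi p) (ltnW m1)); last first.
  by rewrite -sqnE sqc -(sqc p1) sqnE tr1 !trE.
by rewrite trE mulrAC divff// mul1r.
Qed.

End ConstantMeanCurvature.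

(** * Umbilic hypersurfaces *)

Section UmbilicHypersurface.
Variables (R : realType) (m : nat) (M : riemannianManifold R m).
Variables (phi xi : M -> 'rV[R]_m.+1).
Hypothesis hphi : isometric_immersion phi.
Hypothesis hxi : unit_normal phi xi.
Hypothesis m0 : (0 < m)%N.
Variable c : R.
Hypothesis c0 : c != 0.
Local Notation idx := (atlas_index M).
Local Notation K := (smooth_fun M).
Local Notation d_ := (tangential_d hphi).
Local Notation nu_ := (normal_coord hxi).
Local Notation x_ := (position_coord hphi).
Local Notation form_ := (second_form hphi hxi).
Local Notation form_mx := (form_mx hphi hxi).
Local Notation S := (shape_operator phi xi).
Hypothesis umb : forall p, form_mx p = c *: tangent_proj (xi p).

Lemma shape_scalar (i : idx) p : dom (atlas i) p -> S i p = c%:M.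
Proof.
move=> ip; rewrite (shape_form hphi hxi ip) umb -(tang_jac hphi hxi ip).
rewrite -scalemxAr -scalemxAl (mulmxA (jac phi i p) (tang phi i p)).
rewrite (jac_tang hphi ip) mul1mx (jac_tang hphi ip).
by rewrite scalemx1.
Qed.

Lemma umbilic_parallel : parallel S.
Proof.
move=> X Y _ [sY _] i p ip; rewrite /nabla_endo.
have AY q : dom (atlas i) q -> apply_endo S Y i q = c *: Y i q.
  by move=> iq; rewrite /apply_endo shape_scalar// mul_mx_scalar.
have dAY k : partial (apply_endo S Y i) i k p = c *: partial (Y i) i k p.
  rewrite /partial -deriveZ; last first.
    by apply: smooth_derivable (sY i) _; exact: cod_coord.
  apply: (eq_on_derive (open_cod i)); last exact: cod_coord.
  by move=> x /codP[iq _]; exact: AY.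
have -> : nabla X (apply_endo S Y) i p = c *: nabla X Y i p.
  rewrite /nabla scaler_sumr; apply: eq_bigr => k _.
  rewrite dAY AY// scalerA mulrC -scalerA; congr (_ *: _); rewrite scalerDr.
  congr (_ + _); apply/rowP => r; rewrite !mxE mulr_sumr.
  by apply: eq_bigr => l _; rewrite mxE mulrCA.
by rewrite [X in _ - X]/apply_endo shape_scalar// mul_mx_scalar subrr.
Qed.

(** The field [xi + c *: phi] has zero derivative. *)
Lemma umbilic_center : [set: M] !=set0 ->
  exists z : 'rV[R]_m.+1, forall p, phi p - z = - c^-1 *: xi p.
Proof.
move=> [p0 _]; exists (c^-1 *: (xi p0 + c *: phi p0)) => p.
suff -> : xi p0 + c *: phi p0 = xi p + c *: phi p.
  by rewrite scalerDr scalerA mulVf// scale1r opprD addrCA subrr addr0 scaleNr.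
apply/rowP => b; rewrite !mxE.
pose u : K := nu_ b + const_fun M c * x_ b.
have uE q : u q = xi q 0 b + c * phi q 0 b by rewrite smooth_addE smooth_mulE.
rewrite -!uE; apply: (d_eq0_cst (hphi := hphi)) => a.
apply: smooth_fun_inj => q.
rewrite (d_D hphi) (d_M hphi) (d_const hphi) mulr0 addr0 (d_x hphi hxi).
rewrite smooth_addE smooth_mulE smooth_addE smooth_oppE smooth_natE smooth_mulE.
rewrite smooth_zeroE -[d_ a (nu_ b)]opprK -/(form_ a b) smooth_oppE.
have -> : form_ a b q = form_mx q a b by rewrite mxE.
rewrite -[const_fun M c q]/c -[nu_ a q]/(xi q 0 a) -[nu_ b q]/(xi q 0 b).
by rewrite umb /tangent_proj !mxE big_ord1 !mxE; ring.
Qed.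

Lemma dot_normal p : dot (xi p) (xi p) = 1.
Proof. by have [_ + _] := hxi; apply. Qed.

Lemma not_constant z : [set: M] !=set0 -> ~ (forall p, phi p = z).
Proof.
move=> [p _] cst_phi.
have P0 : tangent_proj (xi p) = 0.
  apply/matrixP => a b; rewrite [RHS]mxE.
  have : d_ a (x_ b) p = 0.
    have -> : x_ b = const_fun M (z 0 b).
      by apply: smooth_fun_inj => q /=; rewrite cst_phi.
    by rewrite (d_const hphi) smooth_zeroE.
  rewrite (d_x hphi hxi) smooth_addE smooth_oppE smooth_natE smooth_mulE => <-.
  by rewrite /tangent_proj !mxE big_ord1 !mxE.
have := tr_proj (dot_normal p); rewrite P0 mxtrace0 => /esym/eqP.
by rewrite pnatr_eq0 -leqn0 leqNgt m0.
Qed.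

(** For surjectivity, let [p] maximise the height in the direction of a point [y]
    of the sphere: the normal at [p] is parallel to [y], so [p] is sent to [y] or
    to [- y], up to the centre. The latter is the lowest point of the sphere, and
    [phi] would be constant. *)
Lemma umbilic_sphere : compact [set: M] -> [set: M] !=set0 ->
  exists r : R, 0 < r /\ congruent (phi @` [set: M]) (@sphere R m.+1 r).
Proof.
move=> cM M0; have [z zP] := umbilic_center M0.
have r0 : 0 < `|c^-1| by rewrite normr_gt0 invr_eq0.
have dotz p : dot (phi p - z) (phi p - z) = c^-1 ^+ 2.
  by rewrite zP dotZl dotZr dot_normal mulr1 mulrNN expr2.
exists `|c^-1|; split => //; exists (fun x => x - z); split.
  by move=> x y; rewrite opprB addrA subrK.
rewrite image_comp; apply/seteqP; split=> [_ [p _ <-]|y].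
  by rewrite /sphere /= /enorm dotz sqrtr_sqr.
rewrite /sphere /= => ynorm.
have yy : dot y y = c^-1 ^+ 2.
  by rewrite -[LHS]sqr_sqrtr ?dot_ge0// -/(enorm y) ynorm real_normK ?num_real.
pose u : K := \sum_b const_fun M (y 0 b) * x_ b.
have uE q : u q = dot y (phi q).
  by rewrite sum_smoothE; apply: eq_bigr => b _; rewrite smooth_mulE.
have [p pmax] := smooth_max u cM M0.
have yk : y = dot y (xi p) *: xi p.
  apply/rowP => a; rewrite mxE.
  have : d_ a u p = 0 by apply: d_at_max; near=> q; exact: pmax.
  rewrite (deriv_sum (d_D hphi)) sum_smoothE => /eqP; rewrite -subr_eq0 => /eqP E.
  apply/eqP; rewrite -subr_eq0; apply/eqP; rewrite -[RHS]E subr0.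
  transitivity (\sum_b (y 0 b * (a == b)%:R - y 0 b * xi p 0 b * xi p 0 a)).
    rewrite sumrB -mulr_suml (bigD1 a)//= eqxx mulr1 big1 ?addr0// => b /negPf ba.
    by rewrite eq_sym ba mulr0.
  apply: eq_bigr => b _; rewrite (d_M hphi) (d_const hphi) mulr0 addr0 (d_x hphi hxi).
  rewrite smooth_mulE smooth_addE smooth_oppE smooth_natE smooth_mulE.
  by rewrite mulrBr; congr (_ - _); rewrite -mulrA; congr (_ * _); rewrite mulrC.
set k := dot y (xi p) in yk.
have : k ^+ 2 = c^-1 ^+ 2.
  by rewrite -yy yk dotZl dotZr dot_normal mulr1 expr2.
move=> /eqP; rewrite eqf_sqr => /orP[/eqP kE|/eqP kE]; last first.
  by exists p => //=; rewrite zP yk kE.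
exfalso; apply: (@not_constant (z - y)) => // q.
have py : phi p - z = - y by rewrite zP yk kE scaleNr.
have le : dot y (phi q - z) <= - dot y y.
  by rewrite -dotNr -py dotDr [leRHS]dotDr lerD2r -!uE.
apply/eqP; rewrite -subr_eq0 opprB addrCA addrC -dot_eq0 eq_le dot_ge0 andbT.
move: le (dotz q); rewrite yy; move: (phi q - z) => w le ww.
rewrite dotDl !dotDr yy (dotC w y) ?ww; lra.
Unshelve. all: by end_near. Qed.

End UmbilicHypersurface.

Theorem theorem1p2 (R : realType) (m : nat) (M : riemannianManifold R m)
    (phi xi : M -> 'rV[R]_m.+1)
    (hcompact : compact [set: M])
    (hphi : isometric_immersion phi)
    (hxi : unit_normal phi xi)
    (hnonmin : non_minimal phi xi)
    (hbicons : biconservative phi xi)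
    (hm : (7 <= m)%N)
    (hA : forall p : M, shape_sqnorm phi xi p <=
            m%:R ^+ 2 * mean_curvature phi xi p ^+ 2 / (m%:R - 1)) :
  parallel (shape_operator phi xi) /\
  exists r : R, 0 < r /\ congruent (phi @` [set: M]) (@sphere R m.+1 r).
Proof.
have m1 : (1 < m)%N by exact: leq_trans hm.
have M0 : [set: M] !=set0 by case: hnonmin => p _; exists p.
have [c c0 fc] := mean_curvature_cst hphi hxi m1 hA hbicons hnonmin.
have umb := umbilic hphi hxi hcompact m1 c0 fc hA M0.
split; first exact: umbilic_parallel umb.
exact: (umbilic_sphere (ltnW m1) c0 umb hcompact M0).
Qed.
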